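(* Let $\sum_{n=0}^\infty a_n z^n$ be a power series that has only poles (and no other singularities) on the circle of convergence $|z|=\rho$, as well as no other singularities inside the circle $|z|=\rho_1>\rho$. Let $\epsilon>0$ be such that $\frac{1}{\rho_1}<\frac{1}{\rho}-2\epsilon$. If $v_n$ is the number of coefficients $a_j$ with $|a_j|>\left(\frac{1}{\rho}-\epsilon\right)^j$ among the $n$ coefficients $a_0,a_1,\dots,a_{n-1}$, then the number of poles on the circle of convergence is not smaller than $\limsup_{n\to\infty}\frac{n}{v_n}$.
   Context: The power series has complex coefficients and finite radius of convergence $\rho>0$. Singularities and poles are those of the function represented by the power series; the hypothesis means that this function continues meromorphically to $\{|z|<\rho_1\}$ and that all its singularities there are poles lying on $|z|=\rho$. *)

(* Defs.v *)
From Stdlib Require Import Reals List.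
From Coquelicot Require Import Coquelicot.
Open Scope R_scope.

(* The complex power series [sum_n c n * z ^ n] converges and its sum is [s]. *)
Definition is_cpseries (c : nat -> C) (z s : C) : Prop :=
  @is_pseries C_AbsRing C_NormedModule c z s.

(* [CV_radius] is only available for real coefficients; the disk of absolute
   convergence of [sum a n * z ^ n] only depends on the moduli of the [a n]. *)
Definition cradius (a : nat -> C) : Rbar := CV_radius (fun n => Cmod (a n)).

Definition analytic_at (f : C -> C) (z0 : C) : Prop :=
  exists (c : nat -> C) (r : R), 0 < r /\
    forall z : C, Cmod (z - z0) < r -> is_cpseries c (z - z0)%C (f z).

(* A pole of order [m >= 1]; the value of [f] at [z0] itself is irrelevant. *)
Definition pole_at (f : C -> C) (z0 : C) : Prop :=
  exists (m : nat) (g : C -> C) (r : R),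
    (1 <= m)%nat /\ analytic_at g z0 /\ g z0 <> RtoC 0 /\ 0 < r /\
    forall z : C, 0 < Cmod (z - z0) < r -> f z = (g z / (z - z0) ^ m)%C.

(* [f] is the meromorphic continuation to [|z| < rho1] of the power series with
   coefficients [a], and its only singularities there are poles on [|z| = rho]. *)
Definition continues_with_poles_on_circle
    (a : nat -> C) (rho rho1 : R) (f : C -> C) : Prop :=
  (forall z : C, Cmod z < rho -> is_cpseries a z (f z)) /\
  (forall z : C, Cmod z < rho1 ->
     analytic_at f z \/ (Cmod z = rho /\ pole_at f z)).

Definition has_card {T : Type} (P : T -> Prop) (p : nat) : Prop :=
  exists l : list T, NoDup l /\ (forall x : T, In x l <-> P x) /\ length l = p.

Definition large_count (a : nat -> C) (t : R) (n : nat) : nat :=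
  length (filter (fun j => if Rlt_dec (t ^ j) (Cmod (a j)) then true else false)
                 (seq 0 n)).

(* Main.v *)
Require Import Defs.
From Stdlib Require Import Reals List Lra Lia Classical IndefiniteDescription Compare_dec Factorial.
From Coquelicot Require Import Coquelicot.
Open Scope R_scope.

(* Subtracting the leading polar terms [k / (1 - z / alpha) ^ M] at the poles one at a time lowers the pole
   orders, so a function with poles of order at most [M] on [|z| = rho] has coefficients
   [O (n ^ (M - 1) * rho ^ - n)]; a function without boundary singularity has a larger radius of convergence.
   Let [alpha] be a pole of maximal order [m] among the [p] distinct poles, and multiply [f] by the [p - 1]
   factors [z - beta], [beta] running over the other poles.  The order drops to at most [m - 1] at every
   [beta] and stays [m] at [alpha], so the new [n]-th coefficient is of exact size
   [n ^ (m - 1) * rho ^ - n].  It is a fixed linear combination of [p] consecutive [a j], hence for large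
   [n] one of them exceeds [(1 / rho - eps) ^ j]. *)

(** * Complex series *)

(** That regularity on all of |z| = rho enlarges the radius of convergence is proved without
    integrals. Averaging over rotations gives Cauchy's estimate on a circle inside the disk. Near a
    boundary point w the inner and the local expansion are compared only where their disks overlap;
    all their derivatives agree there, so the k-th derivative of the inner series is bounded by a
    multiple of k! (2 q) ^ k. Compactness makes the constants uniform on a circle |z| = rho - eta,
    and binomial expansion from that circle reaches beyond rho.

    Singularities are therefore described from inside: a local expansion has to match the function
    only where |z| < rho, and values at or beyond a pole never enter.

    The factor of alpha is left out of the product for two reasons: with all p factors the order at
    alpha would drop as well, leaving no dominant term, and the windows would have p + 1 entries
    instead of p. *)

Definition csum (x : nat -> C) (s : C) : Prop :=
  @is_series C_AbsRing C_NormedModule x s.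

Lemma csum_ext (x y : nat -> C) (s : C) :
  (forall n, x n = y n) -> csum x s -> csum y s.
Proof. intros H. apply is_series_ext. exact H. Qed.

Lemma is_cpseriesE (c : nat -> C) (z s : C) :
  is_cpseries c z s <-> csum (fun n => (c n * z ^ n)%C) s.
Proof.
assert (E : forall n, scal (pow_n (K := C_AbsRing) z n) (c n) = (c n * z ^ n)%C).
{ intros n.
  assert (P : pow_n (K := C_AbsRing) z n = (z ^ n)%C).
  { induction n as [|n IH]; [reflexivity|]. simpl. rewrite IH. reflexivity. }
  rewrite P. unfold scal. simpl. unfold mult. simpl. ring. }
split; apply is_series_ext; intros n; rewrite E; reflexivity.
Qed.

Lemma csum_plus (x y : nat -> C) (s t : C) :
  csum x s -> csum y t -> csum (fun n => (x n + y n)%C) (s + t)%C.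
Proof. exact (is_series_plus (K := C_AbsRing) (V := C_NormedModule) x y s t). Qed.

Lemma csum_scal (k : C) (x : nat -> C) (s : C) :
  csum x s -> csum (fun n => (k * x n)%C) (k * s)%C.
Proof. exact (is_series_scal (K := C_AbsRing) (V := C_NormedModule) k x s). Qed.

Lemma csum_minus (x y : nat -> C) (s t : C) :
  csum x s -> csum y t -> csum (fun n => (x n - y n)%C) (s - t)%C.
Proof. exact (is_series_minus (K := C_AbsRing) (V := C_NormedModule) x y s t). Qed.

Lemma csum_tail (x : nat -> C) (s : C) :
  csum x s -> csum (fun n => x (S n)) (s - x 0%nat)%C.
Proof.
intros H. apply (is_series_incr_1 (K := C_AbsRing) (V := C_NormedModule)).
change (csum x ((s - x 0%nat) + x 0%nat)%C).
replace ((s - x 0%nat) + x 0%nat)%C with s by ring. exact H.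
Qed.

Lemma csum_cons (x : nat -> C) (s : C) :
  csum (fun n => x (S n)) s -> csum x (s + x 0%nat)%C.
Proof.
intros H. apply (is_series_decr_1 (K := C_AbsRing) (V := C_NormedModule)).
change (csum (fun n => x (S n)) ((s + x 0%nat) + - x 0%nat)%C).
replace ((s + x 0%nat) + - x 0%nat)%C with s by ring. exact H.
Qed.

Lemma csum_unique (x : nat -> C) (s t : C) : csum x s -> csum x t -> s = t.
Proof.
intros H1 H2.
exact (filterlim_locally_unique (K := C_AbsRing) (V := C_NormedModule) _ _ _ H1 H2).
Qed.

Lemma csum_0 : csum (fun _ => RtoC 0) 0.
Proof.
apply (filterlim_ext (fun _ => RtoC 0)); [|apply filterlim_const].
intros k. symmetry. induction k as [|k IHk]; [apply sum_O|].
rewrite sum_Sn. etransitivity; [apply (f_equal (fun u => plus u _)); exact IHk|].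
unfold plus. simpl. ring.
Qed.

Lemma csum_single (x : nat -> C) (n : nat) :
  (forall k, k <> n -> x k = RtoC 0) -> csum x (x n).
Proof.
revert x. induction n as [|n IH]; intros x H.
- assert (Z : csum (fun k => x (S k)) 0).
  { apply csum_ext with (fun _ => RtoC 0); [|exact csum_0].
    intros k. rewrite H by lia. reflexivity. }
  apply csum_cons in Z. rewrite Cplus_0_l in Z. exact Z.
- assert (Z := csum_cons x (x (S n)) (IH (fun k => x (S k)) (fun k Hk => H (S k) ltac:(lia)))).
  rewrite (H 0%nat) in Z by lia. rewrite Cplus_0_r in Z. exact Z.
Qed.

Lemma csum_eps (x : nat -> C) (s : C) : csum x s -> forall e, 0 < e ->
  exists N, forall n, (N <= n)%nat -> Cmod (sum_n (G := C_NormedModule) x n - s)%C < e.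
Proof.
intros H e He.
assert (H' := proj1 (filterlim_locally_ball_norm (K := C_AbsRing) (U := C_NormedModule) _ _) H (mkposreal e He)).
destruct H' as [N HN]. exists N. intros n Hn. exact (HN n Hn).
Qed.

Lemma Cmod_sum_n_le (x : nat -> C) (b : nat -> R) :
  (forall n, Cmod (x n) <= b n) ->
  forall n, Cmod (sum_n (G := C_NormedModule) x n) <= sum_n b n.
Proof.
intros H n. induction n as [|n IH].
- rewrite !sum_O. apply H.
- rewrite !sum_Sn. unfold plus at 1. simpl.
  eapply Rle_trans; [apply Cmod_triangle|]. apply Rplus_le_compat; auto.
Qed.

Lemma sum_n_le_series (b : nat -> R) (B : R) :
  (forall n, 0 <= b n) -> is_series b B -> forall n, sum_n b n <= B.
Proof.
intros Hb HB n.
apply (is_lim_seq_incr_compare (sum_n b) B); [exact HB|].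
intros k. rewrite sum_Sn. unfold plus. simpl. specialize (Hb (S k)). lra.
Qed.

Lemma csum_Cmod_le (x : nat -> C) (s : C) (b : nat -> R) (B : R) :
  csum x s -> (forall n, Cmod (x n) <= b n) -> is_series b B -> Cmod s <= B.
Proof.
intros Hx Hb HB. apply Rnot_lt_le. intros Hlt.
destruct (csum_eps x s Hx (Cmod s - B) ltac:(lra)) as [N HN].
specialize (HN N (Nat.le_refl N)).
assert (H1 := Cmod_sum_n_le x b Hb N).
assert (H2 := sum_n_le_series b B (fun n => Rle_trans _ _ _ (Cmod_ge_0 _) (Hb n)) HB N).
assert (H3 := Cmod_triangle (s - sum_n (G := C_NormedModule) x N)%C (sum_n (G := C_NormedModule) x N)).
replace (s - sum_n (G := C_NormedModule) x N + sum_n (G := C_NormedModule) x N)%C with s in H3 by ring.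
rewrite <- Cmod_opp in HN.
replace (- (sum_n (G := C_NormedModule) x N - s))%C with (s - sum_n (G := C_NormedModule) x N)%C in HN by ring.
lra.
Qed.

Lemma csum_ex (x : nat -> C) (b : nat -> R) :
  (forall n, Cmod (x n) <= b n) -> ex_series b -> exists s, csum x s.
Proof.
intros H Hb.
exact (ex_series_le (K := C_AbsRing) (V := C_CompleteNormedModule) x b H Hb).
Qed.

Lemma bounded_of_eventually (u : nat -> R) (N : nat) (K : R) :
  (forall n, (N <= n)%nat -> u n <= K) ->
  exists K', 0 <= K' /\ forall n, u n <= K'.
Proof.
revert K. induction N as [|N IH]; intros K H.
- exists (Rmax 0 K). split; [apply Rmax_l|]. intros n.
  eapply Rle_trans; [apply H; lia|apply Rmax_r].
- apply (IH (Rmax K (u N))). intros n Hn.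
  destruct (Nat.eq_dec n N) as [->|Hne]; [apply Rmax_r|].
  eapply Rle_trans; [apply H; lia|apply Rmax_l].
Qed.

Lemma csum_bounded (x : nat -> C) (s : C) : csum x s ->
  exists K, 0 <= K /\ forall n, Cmod (x n) <= K.
Proof.
intros H. destruct (csum_eps x s H 1 Rlt_0_1) as [N HN].
apply (bounded_of_eventually (fun n => Cmod (x n)) (S N) 2).
intros [|n] Hn; [lia|].
assert (H1 := HN n ltac:(lia)). assert (H2 := HN (S n) ltac:(lia)).
rewrite sum_Sn in H2. unfold plus in H2. simpl in H2.
set (S0 := sum_n (G := C_NormedModule) x n) in *.
change (sum_n (fun k : nat => x k) n) with S0 in H2.
replace (x (S n)) with ((S0 + x (S n) - s) + - (S0 - s))%C by ring.
eapply Rle_trans; [apply Cmod_triangle|]. rewrite Cmod_opp. lra.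
Qed.

(** * Cauchy's estimate *)

(** The witness is exp (i * PI / j), with its powers computed by de Moivre's formula. *)
Lemma unit_root_of_minus_one (j : nat) : (1 <= j)%nat ->
  exists zeta : C, Cmod zeta = 1 /\ (zeta ^ j)%C = (- (1))%C.
Proof.
intros Hj. set (x := PI / INR j).
assert (Moivre : forall k, ((cos x, sin x) ^ k)%C = (cos (INR k * x), sin (INR k * x))).
{ induction k as [|k IH].
  - simpl. rewrite Rmult_0_l, cos_0, sin_0. reflexivity.
  - rewrite Cpow_S, IH, S_INR, Rmult_plus_distr_r, Rmult_1_l.
    rewrite cos_plus, sin_plus. unfold Cmult. simpl. f_equal; ring. }
exists (cos x, sin x). split.
- unfold Cmod. simpl. rewrite !Rmult_1_r.
  replace (cos x * cos x + sin x * sin x) with 1; [apply sqrt_1|].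
  generalize (sin2_cos2 x). unfold Rsqr. lra.
- rewrite Moivre. unfold x. replace (INR j * (PI / INR j)) with PI.
  + rewrite cos_PI, sin_PI. unfold Copp. simpl. f_equal; ring.
  + field. apply not_0_INR. lia.
Qed.


(** The tail keeps its indices and has zeros up to m, so that it can dominate termwise a series
    whose first terms vanish. *)
Lemma series_tail_small (B : nat -> R) (e : R) :
  ex_series B -> 0 < e -> exists N, forall m, (N <= m)%nat ->
  exists l, l < e /\ is_series (fun k => if le_dec k m then 0 else B k) l.
Proof.
intros [T HT] He. change R in T.
assert (H' := proj2 (is_lim_seq_spec (sum_n B) T) HT (mkposreal e He)).
destruct H' as [N HN]. exists N. intros m Hm.
specialize (HN m Hm). simpl in HN. apply Rabs_def2 in HN.
exists (T - sum_n B m). split; [lra|].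
apply (is_series_decr_n (K := R_AbsRing) (V := R_NormedModule)) with (n := S m); [lia|].
simpl pred.
assert (Z : sum_n (fun k => if le_dec k m then 0 else B k) m = 0).
{ transitivity (sum_n (fun _ => 0) m).
  - apply sum_n_ext_loc. intros k Hk. destruct (le_dec k m); [reflexivity|lia].
  - rewrite sum_n_const. apply Rmult_0_r. }
change (is_series (fun k => if le_dec (S m + k) m then 0 else B (S m + k)%nat)
  (T - sum_n B m + - sum_n (fun k => if le_dec k m then 0 else B k) m)).
rewrite Z, Ropp_0, Rplus_0_r.
apply is_series_ext with (fun k => B (S m + k)%nat).
{ intros k. destruct (le_dec _ m); [lia|reflexivity]. }
apply (is_series_incr_n (K := R_AbsRing) (V := R_NormedModule)); [lia|].
change (is_series B (T - sum_n B m + sum_n B m)).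
replace (T - sum_n B m + sum_n B m) with T by (unfold minus; simpl; ring). exact HT.
Qed.

Lemma C2_nz : RtoC 2 <> 0.
Proof. intros H. apply RtoC_inj in H. lra. Qed.

Definition bounded_on_circle (s M : R) (d : nat -> C) : Prop :=
  forall z v, Cmod z = s -> csum (fun k => (d k * z ^ k)%C) v -> Cmod v <= M.

(* Averaging [F z] with [zeta ^ - n * F (zeta * z)], where [zeta ^ j = -1],
   keeps the coefficient of index [n] and kills those of index [n + j], [n - j]. *)
Lemma averaging (s M : R) (n : nat) (b : nat -> C) : ex_series (fun k => Cmod (b k) * s ^ k) ->
  bounded_on_circle s M b ->
  forall J, exists d : nat -> C,
    (forall k, Cmod (d k) <= Cmod (b k)) /\ d n = b n /\
    (forall k, k <> n -> (k <= n + J)%nat -> (n <= k + J)%nat -> d k = RtoC 0) /\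
    bounded_on_circle s M d.
Proof.
intros Hb HM J. induction J as [|J (d & Hd & Hn & H0 & HB)].
- exists b. split; [intros k; apply Rle_refl|]. split; [reflexivity|].
  split; [intros; lia|exact HM].
- destruct (unit_root_of_minus_one (S J) ltac:(lia)) as (zeta & Hz1 & HzJ).
  assert (Hc : (zeta * Cconj zeta)%C = 1).
  { rewrite <- Cmod2_conj, Hz1. f_equal. ring. }
  assert (Hcm : Cmod (Cconj zeta) = 1) by (rewrite Cmod_conj; exact Hz1).
  assert (HcJ : (Cconj zeta ^ S J)%C = (- (1))%C).
  { rewrite <- Cpow_conj, HzJ. unfold Cconj, Copp. simpl. f_equal; ring. }
  assert (Hcn : forall m, (zeta ^ m * Cconj zeta ^ m)%C = 1).
  { intros m. rewrite <- Cpow_mult_l, Hc, Cpow_1_l. reflexivity. }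
  (* [Cconj zeta] is the inverse of zeta, so the multiplier is (1 + zeta ^ (k - n)) / 2: it is 1 at
     k = n, 0 at distance S J from n, and of modulus at most 1 everywhere. *)
  exists (fun k => (/ 2 * (d k * (1 + zeta ^ k * Cconj zeta ^ n)))%C).
  assert (Hw : forall k, Cmod (/ 2 * (d k * (1 + zeta ^ k * Cconj zeta ^ n)))%C <= Cmod (d k)).
  { intros k. rewrite !Cmod_mult, (Cmod_inv 2 C2_nz).
    rewrite Cmod_R, (Rabs_right 2) by lra.
    assert (H1 : Cmod (1 + zeta ^ k * Cconj zeta ^ n)%C <= 2).
    { eapply Rle_trans; [apply Cmod_triangle|].
      rewrite Cmod_1, Cmod_mult, !Cmod_pow, Hz1, Hcm, !pow1. lra. }
    generalize (Cmod_ge_0 (d k)). nra. }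
  split; [|split; [|split]].
  + intros k. eapply Rle_trans; [apply Hw|apply Hd].
  + rewrite Hn, Hcn. field.
  + intros k Hk H1 H2.
    destruct (Nat.eq_dec k (n + S J)) as [->|Hk1].
    { rewrite Cpow_add_r, HzJ. replace (zeta ^ n * - (1) * Cconj zeta ^ n)%C
        with (- (zeta ^ n * Cconj zeta ^ n))%C.
      - rewrite Hcn. ring.
      - ring. }
    destruct (Nat.eq_dec n (k + S J)) as [E|Hk2].
    { rewrite E, Cpow_add_r, HcJ. replace (zeta ^ k * (Cconj zeta ^ k * - (1)))%C
        with (- (zeta ^ k * Cconj zeta ^ k))%C.
      - rewrite Hcn. ring.
      - ring. }
    rewrite H0 by lia. ring.
  + intros z v Hz Hv.
    assert (Hex : forall y, Cmod y = s -> exists v', csum (fun k => (d k * y ^ k)%C) v').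
    { intros y Hy. apply csum_ex with (fun k => Cmod (b k) * s ^ k); [|exact Hb].
      intros k. rewrite Cmod_mult, Cmod_pow, Hy. apply Rmult_le_compat_r; [|apply Hd].
      apply pow_le. rewrite <- Hy. apply Cmod_ge_0. }
    destruct (Hex z Hz) as [v1 Hv1].
    assert (Hz2 : Cmod (zeta * z)%C = s) by (rewrite Cmod_mult, Hz1, Hz; ring).
    destruct (Hex (zeta * z)%C Hz2) as [v2 Hv2].
    assert (Hs := csum_scal (/ 2)%C _ _ (csum_plus _ _ _ _ Hv1 (csum_scal (Cconj zeta ^ n)%C _ _ Hv2))).
    assert (E : v = (/ 2 * (v1 + Cconj zeta ^ n * v2))%C).
    { apply (csum_unique _ _ _ Hv). eapply csum_ext; [|exact Hs].
      intros k. simpl. rewrite Cpow_mult_l. ring. }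
    rewrite E, Cmod_mult, (Cmod_inv 2 C2_nz).
    rewrite Cmod_R, (Rabs_right 2) by lra.
    assert (H1 := HB _ _ Hz Hv1). assert (H2 := HB _ _ Hz2 Hv2).
    assert (H3 := Cmod_triangle v1 (Cconj zeta ^ n * v2)%C).
    rewrite Cmod_mult, Cmod_pow, Hcm, pow1 in H3. lra.
Qed.

(** After averaging away all other low indices, the value at z = s is b n * s ^ n up to a tail
    smaller than any supposed excess over M. *)
Lemma cauchy_estimate (s M : R) (n : nat) (b : nat -> C) : 0 <= s ->
  ex_series (fun k => Cmod (b k) * s ^ k) ->
  bounded_on_circle s M b ->
  Cmod (b n) * s ^ n <= M.
Proof.
intros Hs Hb HM. apply Rnot_lt_le. intros Hlt.
destruct (series_tail_small _ (Cmod (b n) * s ^ n - M) Hb ltac:(lra)) as [N HN].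
(* Averaging with J = n + N kills every k < n and every k with n < k <= n + J, so the tail starts
   after n + J. *)
destruct (HN (n + (n + N))%nat ltac:(lia)) as (l & Hl & Hser).
destruct (averaging s M n b Hb HM (n + N)%nat) as (d & Hd & Hn & H0 & HB).
assert (Hsm : Cmod s = s) by (rewrite Cmod_R; apply Rabs_right; lra).
assert (Hterm : forall k, Cmod (d k * s ^ k)%C <= Cmod (b k) * s ^ k).
{ intros k. rewrite Cmod_mult, Cmod_pow, Hsm.
  apply Rmult_le_compat_r; [apply pow_le; lra|apply Hd]. }
destruct (csum_ex _ _ Hterm Hb) as [v Hv].
assert (Hvm := HB _ _ Hsm Hv).
assert (H1 := csum_single (fun k => if Nat.eq_dec k n then (d k * s ^ k)%C else RtoC 0) n
   ltac:(intros k Hk; cbv beta; destruct (Nat.eq_dec k n); [contradiction|reflexivity])).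
simpl in H1. destruct (Nat.eq_dec n n) as [_|]; [|contradiction].
assert (H2 := csum_minus _ _ _ _ Hv H1).
assert (H3 : Cmod (v - d n * s ^ n)%C <= l).
{ apply (csum_Cmod_le _ _ _ _ H2) with (2 := Hser).
  intros k. simpl.
  destruct (Nat.eq_dec k n) as [->|Hk].
  - replace (d n * s ^ n - d n * s ^ n)%C with (RtoC 0) by ring. rewrite Cmod_0.
    destruct (le_dec _ _); [lra|lia].
  - replace (d k * s ^ k - 0)%C with (d k * s ^ k)%C by ring.
    destruct (le_dec k (n + (n + N))).
    + rewrite H0 by lia. replace (0 * s ^ k)%C with (RtoC 0) by ring. rewrite Cmod_0. lra.
    + apply Hterm. }
assert (H4 := Cmod_triangle v (- (v - d n * s ^ n))%C).
rewrite Cmod_opp in H4.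
replace (v + - (v - d n * s ^ n))%C with (d n * s ^ n)%C in H4 by ring.
rewrite Cmod_mult, Cmod_pow, Hsm in H4. rewrite Hn in H3, H4. lra.
Qed.

(** * Derivatives of power series *)

Definition deriv_at (F : C -> C) (z l : C) : Prop :=
  forall e, 0 < e -> exists d, 0 < d /\ forall h, Cmod h < d ->
    Cmod (F (z + h) - F z - l * h)%C <= e * Cmod h.

Lemma deriv_at_unique (F : C -> C) (z l l' : C) :
  deriv_at F z l -> deriv_at F z l' -> l = l'.
Proof.
intros H H'. apply NNPP. intros Hne.
assert (Hp : 0 < Cmod (l - l')%C).
{ apply Cmod_gt_0. intros E. apply Hne.
  replace l with (l - l' + l')%C by ring. rewrite E. ring. }
destruct (H (Cmod (l - l')%C / 4) ltac:(lra)) as (d & Hd & Hl).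
destruct (H' (Cmod (l - l')%C / 4) ltac:(lra)) as (d' & Hd' & Hl').
set (x := Rmin d d' / 2).
assert (Hx : 0 < x) by (unfold x; generalize (Rmin_pos d d' Hd Hd'); lra).
assert (Hxm : Cmod x = x) by (rewrite Cmod_R; apply Rabs_right; lra).
specialize (Hl x). specialize (Hl' x). rewrite Hxm in Hl, Hl'.
assert (H1 := Hl ltac:(unfold x; generalize (Rmin_l d d'); unfold x in Hx; lra)).
assert (H2 := Hl' ltac:(unfold x; generalize (Rmin_r d d'); unfold x in Hx; lra)).
assert (H3 := Cmod_triangle (F (z + x) - F z - l' * x)%C (- (F (z + x) - F z - l * x))%C).
rewrite Cmod_opp in H3.
replace (F (z + x) - F z - l' * x + - (F (z + x) - F z - l * x))%C with ((l - l') * x)%C in H3 by ring.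
rewrite Cmod_mult, Hxm in H3.
assert (0 < Cmod (l - l')%C * x) by (apply Rmult_lt_0_compat; lra). lra.
Qed.

(** A recursion for the second-order remainder of x ^ n. Its terms are nonnegative for x, H >= 0,
    and its complex analogue has the same shape, which allows a termwise comparison. *)
Lemma pow_remainder_eq (x H : R) (n : nat) :
  (x + H) ^ S n - x ^ S n - INR (S n) * x ^ n * H =
  (x + H) * ((x + H) ^ n - x ^ n - INR n * x ^ pred n * H) + INR n * x ^ pred n * H ^ 2.
Proof. rewrite S_INR. destruct n; simpl pred; simpl pow; [simpl INR|]; ring. Qed.

Lemma pow_remainder_pos (x H : R) (n : nat) : 0 <= x -> 0 <= H ->
  0 <= (x + H) ^ n - x ^ n - INR n * x ^ pred n * H.
Proof.
intros Hx HH. induction n as [|n IH]; [simpl; lra|].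
simpl pred. rewrite pow_remainder_eq.
apply Rplus_le_le_0_compat; [apply Rmult_le_pos; lra|].
repeat apply Rmult_le_pos; try lra; [apply pos_INR|apply pow_le; lra].
Qed.

(** The remainder is a polynomial with nonnegative coefficients in which h occurs at least squared,
    so passing from h to H >= Cmod h gains the factor (Cmod h / H) ^ 2. *)
Lemma Cpow_remainder_le (z h : C) (H : R) (n : nat) : 0 < H -> Cmod h <= H ->
  Cmod ((z + h) ^ n - z ^ n - INR n * z ^ pred n * h)%C <=
  (Cmod h / H) ^ 2 * ((Cmod z + H) ^ n - Cmod z ^ n - INR n * Cmod z ^ pred n * H).
Proof.
intros HH Hh. induction n as [|n IH].
- simpl. replace (1 - 1 - 0 * 1 * h)%C with (RtoC 0) by ring. rewrite Cmod_0. lra.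
- simpl pred. rewrite pow_remainder_eq.
  replace ((z + h) ^ S n - z ^ S n - INR (S n) * z ^ n * h)%C with
    ((z + h) * ((z + h) ^ n - z ^ n - INR n * z ^ pred n * h)
     + INR n * z ^ pred n * (h * h))%C.
  2: { rewrite S_INR, RtoC_plus. destruct n; simpl pred; rewrite !Cpow_S; [simpl INR; simpl Cpow|]; ring. }
  eapply Rle_trans; [apply Cmod_triangle|].
  rewrite Rmult_plus_distr_l. apply Rplus_le_compat.
  + rewrite Cmod_mult.
    replace ((Cmod h / H) ^ 2 * ((Cmod z + H) * ((Cmod z + H) ^ n - Cmod z ^ n - INR n * Cmod z ^ pred n * H)))
    with ((Cmod z + H) * ((Cmod h / H) ^ 2 * ((Cmod z + H) ^ n - Cmod z ^ n - INR n * Cmod z ^ pred n * H))) by ring.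
    apply Rmult_le_compat; try apply Cmod_ge_0; [|exact IH].
    eapply Rle_trans; [apply Cmod_triangle|lra].
  + rewrite !Cmod_mult, Cmod_pow, Cmod_R, Rabs_right by (apply Rle_ge, pos_INR).
    right. field. lra.
Qed.

Definition psum (c : nat -> C) (w z v : C) : Prop :=
  csum (fun n => (c n * (z - w) ^ n)%C) v.

Definition absconv (c : nat -> C) (r : R) : Prop :=
  forall s, 0 <= s < r -> ex_series (fun n => Cmod (c n) * s ^ n).

Definition dseq (c : nat -> C) (n : nat) : C := (INR (S n) * c (S n))%C.

Lemma psum_ex (c : nat -> C) (r : R) (w z : C) :
  absconv c r -> Cmod (z - w)%C < r -> exists v, psum c w z v.
Proof.
intros Hc Hz. apply csum_ex with (fun n => Cmod (c n) * Cmod (z - w)%C ^ n).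
- intros n. rewrite Cmod_mult, Cmod_pow. apply Rle_refl.
- apply Hc. split; [apply Cmod_ge_0|exact Hz].
Qed.

(** INR (S n) * s ^ n * H is one term of the binomial expansion of (s + H) ^ S n; the derived series
    is thus dominated by the original one at a slightly larger radius. *)
Lemma dseq_term_le (c : nat -> C) (n : nat) (s H : R) : 0 <= s -> 0 < H ->
  Cmod (dseq c n) * s ^ n <= / H * (Cmod (c (S n)) * (s + H) ^ S n).
Proof.
intros Hs HH. unfold dseq. rewrite Cmod_mult, Cmod_R, Rabs_right by (apply Rle_ge, pos_INR).
assert (H1 := pow_remainder_pos s H (S n) Hs ltac:(lra)). simpl pred in H1.
assert (H2 : INR (S n) * s ^ n * H <= (s + H) ^ S n).
{ assert (0 <= s ^ S n) by (apply pow_le; lra). lra. }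
apply Rmult_le_reg_r with H; [exact HH|].
replace (/ H * (Cmod (c (S n)) * (s + H) ^ S n) * H) with (Cmod (c (S n)) * (s + H) ^ S n) by (field; lra).
replace (INR (S n) * Cmod (c (S n)) * s ^ n * H) with (Cmod (c (S n)) * (INR (S n) * s ^ n * H)) by ring.
apply Rmult_le_compat_l; [apply Cmod_ge_0|exact H2].
Qed.

Lemma absconv_dseq (c : nat -> C) (r : R) : absconv c r -> absconv (dseq c) r.
Proof.
intros Hc s Hs. set (H := (r - s) / 2).
assert (HH : 0 < H) by (unfold H; lra).
apply (ex_series_le (K := R_AbsRing) (V := R_CompleteNormedModule)) with
  (b := fun n => / H * (Cmod (c (S n)) * (s + H) ^ S n)).
- intros n. unfold norm. simpl. unfold abs. simpl. rewrite Rabs_right.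
  + apply dseq_term_le; lra.
  + apply Rle_ge, Rmult_le_pos; [apply Cmod_ge_0|apply pow_le; lra].
- apply (ex_series_scal (K := R_AbsRing) (V := R_NormedModule) (/ H) (fun n => Cmod (c (S n)) * (s + H) ^ S n)).
  apply (ex_series_incr_1 (fun n => Cmod (c n) * (s + H) ^ n)).
  apply Hc. unfold H. lra.
Qed.

(** The first-order remainder of F is at most (Cmod h / H) ^ 2 * T, with T the absolute sum at
    radius x + H, hence o(h). *)
Lemma psum_deriv (c : nat -> C) (F : C -> C) (r d : R) (w z l : C) :
  absconv c r -> Cmod (z - w)%C < r -> 0 < d ->
  (forall y, Cmod (y - z)%C < d -> psum c w y (F y)) ->
  psum (dseq c) w z l -> deriv_at F z l.
Proof.
intros Hc Hz Hd HF Hl.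
set (x := Cmod (z - w)%C) in *. set (H := (r - x) / 2).
assert (Hx : 0 <= x) by apply Cmod_ge_0.
assert (HH : 0 < H) by (unfold H; lra).
destruct (Hc (x + H) ltac:(unfold H; lra)) as [T HT]. change R in T.
assert (HT0 : 0 <= T).
{ eapply Rle_trans; [|apply (sum_n_le_series _ _ (fun n => Rmult_le_pos _ _ (Cmod_ge_0 (c n)) (pow_le (x + H) n ltac:(lra))) HT 0%nat)].
  rewrite sum_O. apply Rmult_le_pos; [apply Cmod_ge_0|apply pow_le; lra]. }
assert (Hq : forall h, Cmod h < Rmin d H ->
   Cmod (F (z + h) - F z - l * h)%C <= (Cmod h / H) ^ 2 * T).
{ intros h Hh.
  assert (Hh1 : Cmod h < d) by (generalize (Rmin_l d H); lra).
  assert (Hh2 : Cmod h < H) by (generalize (Rmin_r d H); lra).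
  assert (S1 := HF (z + h)%C ltac:(replace (z + h - z)%C with h by ring; exact Hh1)).
  assert (S2 := HF z ltac:(replace (z - z)%C with (RtoC 0) by ring; rewrite Cmod_0; exact Hd)).
  (* The derived series shifted by one index, with a zero term in front, so that it aligns with the
     series of F. *)
  assert (S3 : csum (fun n => (INR n * c n * (z - w) ^ pred n)%C) l).
  { replace l with (l + INR 0 * c 0%nat * (z - w) ^ pred 0)%C by (simpl; ring).
    apply (csum_cons (fun n => (INR n * c n * (z - w) ^ pred n)%C)). exact Hl. }
  assert (S4 := csum_minus _ _ _ _ (csum_minus _ _ _ _ S1 S2) (csum_scal h _ _ S3)).
  replace (l * h)%C with (h * l)%C by ring.
  apply (csum_Cmod_le _ _ (fun n => (Cmod h / H) ^ 2 * (Cmod (c n) * (x + H) ^ n)) _ S4).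
  - intros n. cbv beta.
    replace (c n * (z + h - w) ^ n - c n * (z - w) ^ n - h * (INR n * c n * (z - w) ^ pred n))%C
      with (c n * (((z - w) + h) ^ n - (z - w) ^ n - INR n * (z - w) ^ pred n * h))%C
      by (replace (z + h - w)%C with (z - w + h)%C by ring; ring).
    rewrite Cmod_mult.
    replace ((Cmod h / H) ^ 2 * (Cmod (c n) * (x + H) ^ n)) with
     (Cmod (c n) * ((Cmod h / H) ^ 2 * (x + H) ^ n)) by ring.
    apply Rmult_le_compat_l; [apply Cmod_ge_0|].
    eapply Rle_trans; [apply Cpow_remainder_le with (H := H); lra|]. fold x.
    apply Rmult_le_compat_l; [apply pow2_ge_0|].
    assert (0 <= x ^ n) by (apply pow_le; lra).
    assert (0 <= INR n * x ^ pred n * H).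
    { repeat apply Rmult_le_pos; try lra; [apply pos_INR|apply pow_le; lra]. }
    lra.
  - apply (is_series_scal (K := R_AbsRing) (V := R_NormedModule)). exact HT. }
intros e He.
(* The last bound forces Cmod h * T / H ^ 2 <= e; T + 1 keeps the denominator positive when T =
   0. *)
exists (Rmin (Rmin d H) (e * H ^ 2 / (T + 1))). split.
- repeat apply Rmin_pos; auto. apply Rdiv_lt_0_compat; [|lra].
  apply Rmult_lt_0_compat; [lra|apply pow_lt; lra].
- intros h Hh.
  assert (Hh1 : Cmod h < Rmin d H) by (eapply Rlt_le_trans; [exact Hh|apply Rmin_l]).
  assert (Hh2 : Cmod h < e * H ^ 2 / (T + 1)) by (eapply Rlt_le_trans; [exact Hh|apply Rmin_r]).
  eapply Rle_trans; [apply Hq; exact Hh1|].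
  apply Rmult_lt_compat_r with (r := T + 1) in Hh2; [|lra].
  replace (e * H ^ 2 / (T + 1) * (T + 1)) with (e * H ^ 2) in Hh2 by (field; lra).
  replace ((Cmod h / H) ^ 2 * T) with (Cmod h * (Cmod h * T / H ^ 2)) by (field; lra).
  rewrite (Rmult_comm e). apply Rmult_le_compat_l; [apply Cmod_ge_0|].
  apply Rmult_le_reg_r with (H ^ 2); [apply pow_lt; lra|].
  replace (Cmod h * T / H ^ 2 * H ^ 2) with (Cmod h * T) by (field; lra).
  generalize (Cmod_ge_0 h). nra.
Qed.

(** Both series have the same sum on the open set U, so uniqueness of the derivative identifies
    their derived series there. The common value is given pointwise only; [functional_choice] turns
    it into a function to differentiate. *)
Lemma psum_dseq_agree (a c : nat -> C) (ra rc : R) (wa wc : C) (U : C -> Prop) :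
  absconv a ra -> absconv c rc ->
  (forall z, U z -> Cmod (z - wa)%C < ra /\ Cmod (z - wc)%C < rc /\
     exists d, 0 < d /\ forall y, Cmod (y - z)%C < d -> U y) ->
  (forall z, U z -> exists v, psum a wa z v /\ psum c wc z v) ->
  forall z, U z -> exists v, psum (dseq a) wa z v /\ psum (dseq c) wc z v.
Proof.
intros Ha Hc HU HF z Hz.
destruct (functional_choice (fun y v => U y -> psum a wa y v /\ psum c wc y v)) as [F HF'].
{ intros y. destruct (classic (U y)) as [Hy|Hy].
  - destruct (HF y Hy) as [v Hv]. exists v. auto.
  - exists (RtoC 0). intros; contradiction. }
destruct (HU z Hz) as (Hza & Hzc & d & Hd & Hy).
destruct (psum_ex (dseq a) ra wa z (absconv_dseq _ _ Ha) Hza) as [l Hl].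
destruct (psum_ex (dseq c) rc wc z (absconv_dseq _ _ Hc) Hzc) as [l' Hl'].
assert (E : l = l').
{ apply (deriv_at_unique F z).
  - apply (psum_deriv a F ra d wa z l Ha Hza Hd); [|exact Hl].
    intros y Hyd. apply HF', Hy, Hyd.
  - apply (psum_deriv c F rc d wc z l' Hc Hzc Hd); [|exact Hl'].
    intros y Hyd. apply HF', Hy, Hyd. }
exists l. split; [exact Hl|rewrite E; exact Hl'].
Qed.

(** * Iterated derivatives and their bounds *)

Definition dseqn (k : nat) (c : nat -> C) : nat -> C := Nat.iter k dseq c.

Lemma absconv_dseqn (k : nat) (c : nat -> C) (r : R) : absconv c r -> absconv (dseqn k c) r.
Proof. intros Hc. induction k; [exact Hc|]. apply absconv_dseq. exact IHk. Qed.

Lemma psum_dseqn_agree (a c : nat -> C) (ra rc : R) (wa wc : C) (U : C -> Prop) (k : nat) :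
  absconv a ra -> absconv c rc ->
  (forall z, U z -> Cmod (z - wa)%C < ra /\ Cmod (z - wc)%C < rc /\
     exists d, 0 < d /\ forall y, Cmod (y - z)%C < d -> U y) ->
  (forall z, U z -> exists v, psum a wa z v /\ psum c wc z v) ->
  forall z, U z -> exists v, psum (dseqn k a) wa z v /\ psum (dseqn k c) wc z v.
Proof.
intros Ha Hc HU HF. induction k as [|k IH]; [exact HF|].
apply (psum_dseq_agree _ _ ra rc _ _ U (absconv_dseqn k a ra Ha) (absconv_dseqn k c rc Hc) HU IH).
Qed.

Lemma dseqn_eq (k n : nat) (c : nat -> C) :
  dseqn k c n = (RtoC (INR (fact (n + k)) / INR (fact n)) * c (n + k)%nat)%C.
Proof.
revert n. induction k as [|k IH]; intros n.
- rewrite Nat.add_0_r. unfold Rdiv. rewrite Rinv_r by apply INR_fact_neq_0.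
  simpl. ring.
- change (dseqn (S k) c n) with (dseq (dseqn k c) n). unfold dseq. rewrite IH.
  replace (S n + k)%nat with (n + S k)%nat by lia.
  rewrite Cmult_assoc, <- RtoC_mult. do 2 f_equal.
  rewrite (fact_simpl n), mult_INR. field.
  split; [apply INR_fact_neq_0|apply not_0_INR; lia].
Qed.

Lemma fact_ratio_eq (n k : nat) :
  INR (fact (n + k)) / INR (fact n) = INR (fact k) * Binomial.C (n + k) k.
Proof.
unfold Binomial.C. replace (n + k - k)%nat with n by lia.
field. split; apply INR_fact_neq_0.
Qed.

Lemma Cmod_dseqn (k n : nat) (c : nat -> C) :
  Cmod (dseqn k c n) = INR (fact k) * Binomial.C (n + k) k * Cmod (c (n + k)%nat).
Proof.
rewrite dseqn_eq, fact_ratio_eq, Cmod_mult, Cmod_R, Rabs_right; [reflexivity|].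
rewrite <- fact_ratio_eq. apply Rle_ge, Rlt_le, Rdiv_lt_0_compat; apply INR_fact_lt_0.
Qed.

Lemma binomial_nonneg (n k : nat) : 0 <= Binomial.C n k.
Proof.
unfold Binomial.C. apply Rlt_le, Rdiv_lt_0_compat; [apply INR_fact_lt_0|].
apply Rmult_lt_0_compat; apply INR_fact_lt_0.
Qed.

Lemma sum_f_R0_term_le (u : nat -> R) (n k : nat) :
  (forall i, 0 <= u i) -> (k <= n)%nat -> u k <= sum_f_R0 u n.
Proof.
intros Hu. induction n as [|n IH]; intros Hk.
- replace k with 0%nat by lia. simpl. lra.
- simpl. destruct (Nat.eq_dec k (S n)) as [->|Hne].
  + assert (0 <= sum_f_R0 u n) by (apply cond_pos_sum; exact Hu). lra.
  + specialize (IH ltac:(lia)). specialize (Hu (S n)). lra.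
Qed.

Lemma binomial_le_pow2 (n k : nat) : (k <= n)%nat -> Binomial.C n k <= 2 ^ n.
Proof.
intros Hk. replace 2 with (1 + 1) by ring. rewrite binomial.
set (u := fun i => Binomial.C n i * 1 ^ i * 1 ^ (n - i)).
replace (Binomial.C n k) with (u k) by (unfold u; rewrite !pow1; ring).
apply sum_f_R0_term_le; [|exact Hk].
intros i. unfold u. rewrite !pow1. generalize (binomial_nonneg n i). lra.
Qed.

Lemma is_series_half : is_series (fun n => (/ 2) ^ n) 2.
Proof.
assert (H := is_series_geom (/ 2) ltac:(rewrite Rabs_right; lra)).
replace (/ (1 - / 2)) with 2 in H by field. exact H.
Qed.

(** Bounding the binomial coefficient of n + k over k by 2 ^ (n + k) and Cmod (z - w) by / (4 * q),
    term n is at most K * k! * (2 * q) ^ k * (/ 2) ^ n. *)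
Lemma psum_dseqn_bound (c : nat -> C) (K q : R) (w z v : C) (k : nat) :
  0 < q -> (forall n, Cmod (c n) <= K * q ^ n) -> 4 * q * Cmod (z - w)%C <= 1 ->
  psum (dseqn k c) w z v -> Cmod v <= 2 * K * INR (fact k) * (2 * q) ^ k.
Proof.
intros Hq Hc Hz Hv.
assert (HK : 0 <= K) by (generalize (Hc 0%nat) (Cmod_ge_0 (c 0%nat)); simpl; lra).
assert (Hf := INR_fact_lt_0 k).
assert (H2q : 0 <= (2 * q) ^ k) by (apply pow_le; lra).
apply (csum_Cmod_le _ _ (fun n => K * INR (fact k) * (2 * q) ^ k * (/ 2) ^ n) _ Hv).
- intros n. rewrite Cmod_mult, Cmod_pow, Cmod_dseqn.
  replace (K * INR (fact k) * (2 * q) ^ k * (/ 2) ^ n)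
    with (INR (fact k) * 2 ^ (n + k) * (K * q ^ (n + k)) * (/ (4 * q)) ^ n).
  2: { rewrite !pow_add, !pow_inv, !Rpow_mult_distr.
       replace (4 ^ n) with (2 ^ n * 2 ^ n) by (rewrite <- Rpow_mult_distr; f_equal; ring).
       field. split; apply pow_nonzero; lra. }
  apply Rmult_le_compat.
  + apply Rmult_le_pos; [apply Rmult_le_pos; [lra|apply binomial_nonneg]|apply Cmod_ge_0].
  + apply pow_le, Cmod_ge_0.
  + apply Rmult_le_compat; [|apply Cmod_ge_0| |apply Hc].
    * apply Rmult_le_pos; [lra|apply binomial_nonneg].
    * apply Rmult_le_compat_l; [lra|]. apply binomial_le_pow2. lia.
  + apply pow_incr. split; [apply Cmod_ge_0|].
    apply Rmult_le_reg_l with (4 * q); [lra|]. rewrite Rinv_r; lra.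
- replace (2 * K * INR (fact k) * (2 * q) ^ k) with (K * INR (fact k) * (2 * q) ^ k * 2) by ring.
  apply (is_series_scal (K := R_AbsRing) (V := R_NormedModule)), is_series_half.
Qed.

(* All derivatives of [f] are [O (k! (2 q) ^ k)] on a circle; Cauchy's estimate for each of them, summed
   against [(4 q) ^ - k], reassembles the binomial expansion of [(s + 1 / (4 q)) ^ N]. *)
Lemma coeff_bound_of_dseqn (a : nat -> C) (r s K q : R) :
  absconv a r -> 0 <= s < r -> 0 < q ->
  (forall k z v, Cmod z = s -> psum (dseqn k a) 0 z v ->
     Cmod v <= K * INR (fact k) * (2 * q) ^ k) ->
  forall N, Cmod (a N) * (s + / (4 * q)) ^ N <= 2 * K.
Proof.
intros Ha Hs Hq HB N.
(* Cauchy's estimate for coefficient n of the k-th derivative; k! cancels. *)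
assert (HC : forall n k, Binomial.C (n + k) k * Cmod (a (n + k)%nat) * s ^ n <= K * (2 * q) ^ k).
{ intros n k.
  assert (H := cauchy_estimate s (K * INR (fact k) * (2 * q) ^ k) n (dseqn k a) (proj1 Hs)
    (absconv_dseqn k a r Ha s Hs)).
  rewrite Cmod_dseqn in H.
  apply Rmult_le_reg_l with (INR (fact k)); [apply INR_fact_lt_0|].
  eapply Rle_trans; [|eapply Rle_trans; [apply H|]]; [right; ring| |right; ring].
  intros z v Hz Hv. apply (HB k z v Hz). unfold psum.
  replace (z - 0)%C with z by ring. exact Hv. }
assert (HK : 0 <= K).
{ generalize (HC 0%nat 0%nat) (Cmod_ge_0 (a 0%nat)). rewrite Nat.add_0_r.
  rewrite pascal_step1 by lia. unfold Binomial.C. simpl. lra. }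
replace (s + / (4 * q)) with (/ (4 * q) + s) by ring. rewrite binomial, scal_sum.
apply Rle_trans with (sum_f_R0 (fun k => K * (/ 2) ^ k) N).
- apply sum_Rle. intros k Hk.
  assert (H := HC (N - k)%nat k). replace (N - k + k)%nat with N in H by lia.
  apply Rmult_le_compat_r with (r := (/ (4 * q)) ^ k) in H.
  2: { apply pow_le, Rlt_le, Rinv_0_lt_compat. lra. }
  eapply Rle_trans; [|eapply Rle_trans; [exact H|]]; right; [ring|].
  rewrite Rmult_assoc, <- Rpow_mult_distr. do 2 f_equal. field. lra.
- rewrite <- sum_n_Reals.
  apply sum_n_le_series.
  + intros n. apply Rmult_le_pos; [exact HK|apply pow_le; lra].
  + replace (2 * K) with (K * 2) by ring.
    apply (is_series_scal (K := R_AbsRing) (V := R_NormedModule)), is_series_half.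
Qed.

(** * Coefficients of a function that is regular on the circle of convergence *)

Lemma Cmod_le_Rabs (z : C) : Cmod z <= Rabs (fst z) + Rabs (snd z).
Proof.
destruct z as [x y]. simpl.
replace ((x, y) : C) with (RtoC x + Ci * RtoC y)%C.
- eapply Rle_trans; [apply Cmod_triangle|].
  rewrite Cmod_mult, Cmod_Ci, !Cmod_R. lra.
- unfold Cplus, Cmult, Ci, RtoC. simpl. f_equal; ring.
Qed.

(** The centres come from a cover of the enclosing square and may lie off the disk, so [delta] has
    to be given on the whole plane. Halving it accounts for adding the errors of the two
    coordinates. *)
Lemma finite_subcover (rad : R) (delta : C -> R) : (forall w, 0 < delta w) ->
  exists l : list C, forall z, Cmod z <= rad -> exists t, In t l /\ Cmod (z - t)%C < delta t.
Proof.
intros Hd.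
set (d2 := fun t : Compactness.Tn 2 R =>
  mkposreal (delta (fst t, fst (snd t)) / 2) ltac:(apply Rdiv_lt_0_compat; [apply Hd|lra])).
assert (H := NNPP _ (compactness_list 2 (- rad, (- rad, tt)) (rad, (rad, tt)) d2)).
destruct H as [l Hl].
exists (map (fun t : Compactness.Tn 2 R => (fst t, fst (snd t)) : C) l).
intros [x y] Hz.
assert (Hxy : - rad <= x <= rad /\ - rad <= y <= rad).
{ assert (Hm := Rmax_Cmod (x, y)). simpl in Hm.
  assert (H1 := Rmax_l (Rabs x) (Rabs y)). assert (H2 := Rmax_r (Rabs x) (Rabs y)).
  split; apply Rabs_le_between; lra. }
destruct (Hl (x, (y, tt))) as (t & Ht & _ & Hc).
{ simpl. tauto. }
exists (fst t, fst (snd t)). split.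
{ apply (in_map (fun t : Compactness.Tn 2 R => (fst t, fst (snd t)) : C)). exact Ht. }
destruct t as [t1 [t2 []]]. simpl in *. destruct Hc as (H1 & H2 & _).
eapply Rle_lt_trans; [apply Cmod_le_Rabs|]. simpl.
change (Rabs (x - t1) + Rabs (y - t2) < delta (t1, t2)). lra.
Qed.

Lemma list_upper_bound {T : Type} (l : list T) (u : T -> R) :
  exists B, 0 < B /\ forall t, In t l -> u t <= B.
Proof.
induction l as [|x l (B & HB & H)].
- exists 1. split; [lra|]. intros t [].
- exists (Rmax B (u x)). split; [eapply Rlt_le_trans; [exact HB|apply Rmax_l]|].
  intros t [<-|Ht]; [apply Rmax_r|].
  eapply Rle_trans; [apply H, Ht|apply Rmax_l].
Qed.

(** Abel's lemma, by comparison with the geometric series of ratio x / s. *)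
Lemma absconv_of_bound (c : nat -> C) (s K : R) : 0 < s ->
  (forall n, Cmod (c n) * s ^ n <= K) -> absconv c s.
Proof.
intros Hs HK x Hx.
apply (ex_series_le (K := R_AbsRing) (V := R_CompleteNormedModule)) with
  (b := fun n => K * (x / s) ^ n).
- intros n. unfold norm. simpl. unfold abs. simpl. rewrite Rabs_right.
  + unfold Rdiv. rewrite Rpow_mult_distr, pow_inv.
    replace (Cmod (c n) * x ^ n) with ((Cmod (c n) * s ^ n) * (x ^ n * / s ^ n))
      by (field; apply pow_nonzero; lra).
    apply Rmult_le_compat_r; [|apply HK].
    apply Rmult_le_pos; [apply pow_le; lra|].
    apply Rlt_le, Rinv_0_lt_compat, pow_lt, Hs.
  + apply Rle_ge, Rmult_le_pos; [apply Cmod_ge_0|apply pow_le; lra].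
- apply (ex_series_scal (K := R_AbsRing) (V := R_NormedModule) K (fun n => (x / s) ^ n)).
  exists (/ (1 - x / s)). apply is_series_geom.
  assert (0 <= x / s) by (apply Rmult_le_pos; [lra|apply Rlt_le, Rinv_0_lt_compat, Hs]).
  rewrite Rabs_right by lra.
  apply Rmult_lt_reg_r with s; [exact Hs|]. unfold Rdiv. rewrite Rmult_assoc, Rinv_l; lra.
Qed.

Lemma psum_coeff_bounded (c : nat -> C) (w v : C) (s : R) : 0 <= s ->
  psum c w (w + s)%C v -> exists K, 0 <= K /\ forall n, Cmod (c n) * s ^ n <= K.
Proof.
intros Hs H. destruct (csum_bounded _ _ H) as (K & HK0 & HK). exists K. split; [exact HK0|].
intros n. specialize (HK n). rewrite Cmod_mult, Cmod_pow in HK.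
replace (w + s - w)%C with (RtoC s) in HK by ring.
rewrite Cmod_R, Rabs_right in HK by lra. exact HK.
Qed.

Lemma absconv_of_psum (c : nat -> C) (F : C -> C) (w : C) (r : R) :
  (forall z, Cmod (z - w)%C < r -> psum c w z (F z)) -> absconv c r.
Proof.
intros H s Hs. set (x := (s + r) / 2).
assert (Hx : 0 <= s < x) by (unfold x; lra).
destruct (psum_coeff_bounded c w (F (w + x)%C) x ltac:(lra)) as (K & _ & HK).
- apply H. replace (w + x - w)%C with (RtoC x) by ring.
  rewrite Cmod_R, Rabs_right by lra. unfold x; lra.
- apply (absconv_of_bound c x K); [lra|exact HK|lra].
Qed.

Lemma absconv_of_geometric (c : nat -> C) (K q : R) : 0 < q ->
  (forall n, Cmod (c n) <= K * q ^ n) -> absconv c (/ q).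
Proof.
intros Hq H. apply absconv_of_bound with K; [apply Rinv_0_lt_compat, Hq|].
intros n. rewrite pow_inv. apply Rmult_le_reg_r with (q ^ n); [apply pow_lt, Hq|].
rewrite Rmult_assoc, Rinv_l by (apply pow_nonzero; lra). rewrite Rmult_1_r. apply H.
Qed.

(** The geometric bound gives a positive radius of convergence at w. Agreement with g is asked only
    where Cmod z < rho, so for w on the circle the value g w is irrelevant and z - w may be
    cancelled. *)
Definition local_series (rho : R) (g : C -> C) (w : C) (c : nat -> C) : Prop :=
  (exists K q, 0 < q /\ forall n, Cmod (c n) <= K * q ^ n) /\
  exists r, 0 < r /\
    forall z, Cmod z < rho -> Cmod (z - w)%C < r -> psum c w z (g z).

Definition regular_at (rho : R) (g : C -> C) (w : C) : Prop :=
  exists c, local_series rho g w c.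

Lemma psum_unique (c : nat -> C) (w z v v' : C) : psum c w z v -> psum c w z v' -> v = v'.
Proof. apply csum_unique. Qed.

(** On the overlap of the disk with a small ball around w, the derivatives of the series at 0 equal
    those of the local series, for which [psum_dseqn_bound] holds. *)
Lemma regular_dseqn_bound (a : nat -> C) (rho : R) (f : C -> C) (w : C) :
  (forall z, Cmod z < rho -> psum a 0 z (f z)) -> regular_at rho f w ->
  exists K q d, 0 < q /\ 0 < d /\ forall k z v, Cmod z < rho -> Cmod (z - w)%C < d ->
    psum (dseqn k a) 0 z v -> Cmod v <= K * INR (fact k) * (2 * q) ^ k.
Proof.
intros Ha (c & (K & q & Hq & Hc) & r & Hr & Hcr).
exists (2 * K), q, (Rmin r (/ (4 * q))).
assert (H4 : 0 < / (4 * q)) by (apply Rinv_0_lt_compat; lra).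
split; [exact Hq|]. split; [apply Rmin_pos; lra|].
intros k z v Hz Hzw Hv.
assert (Hm1 := Rmin_l r (/ (4 * q))). assert (Hm2 := Rmin_r r (/ (4 * q))).
assert (Hi : / (4 * q) <= / q) by (apply Rinv_le_contravar; lra).
destruct (psum_dseqn_agree a c rho (/ q) 0 w
  (fun y => Cmod y < rho /\ Cmod (y - w)%C < Rmin r (/ (4 * q))) k) with (z := z)
  as (v' & Hv1 & Hv2).
- apply (absconv_of_psum a f 0). intros y Hy. apply Ha.
  replace (y - 0)%C with y in Hy by ring. exact Hy.
- apply (absconv_of_geometric c K q Hq Hc).
- intros y [Hy1 Hy2]. split; [replace (y - 0)%C with y by ring; exact Hy1|]. split; [lra|].
  set (e1 := rho - Cmod y). set (e2 := Rmin r (/ (4 * q)) - Cmod (y - w)%C).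
  exists (Rmin e1 e2). split; [apply Rmin_pos; unfold e1, e2; lra|].
  intros x Hx. assert (He1 := Rmin_l e1 e2). assert (He2 := Rmin_r e1 e2). split.
  + replace x with ((x - y) + y)%C by ring.
    eapply Rle_lt_trans; [apply Cmod_triangle|]. unfold e1 in *; lra.
  + replace (x - w)%C with ((x - y) + (y - w))%C by ring.
    eapply Rle_lt_trans; [apply Cmod_triangle|]. unfold e2 in *; lra.
- intros y [Hy1 Hy2]. exists (f y). split; [apply Ha, Hy1|apply Hcr; [exact Hy1|lra]].
- split; [exact Hz|exact Hzw].
- rewrite (psum_unique _ _ _ _ _ Hv Hv1).
  apply (psum_dseqn_bound c K q w z v' k Hq Hc); [|exact Hv2].
  apply Rmult_le_reg_l with (/ (4 * q)); [exact H4|].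
  rewrite <- Rmult_assoc, Rinv_l by lra. lra.
Qed.

Lemma coeff_decay_of_regular (a : nat -> C) (rho : R) (f : C -> C) : 0 < rho ->
  (forall z, Cmod z < rho -> psum a 0 z (f z)) ->
  (forall w, Cmod w = rho -> regular_at rho f w) ->
  exists r K, rho < r /\ forall n, Cmod (a n) * r ^ n <= K.
Proof.
intros Hrho Ha Hreg.
destruct (functional_choice (fun (w : C) (p : R * R * R) => let '(K, q, d) := p in 0 < q /\ 0 < d /\
   (Cmod w <> rho -> d <= Rabs (Cmod w - rho) / 2) /\
   (Cmod w = rho -> forall k z v, Cmod z < rho -> Cmod (z - w)%C < d ->
    psum (dseqn k a) 0 z v -> Cmod v <= K * INR (fact k) * (2 * q) ^ k))) as [p Hp].
{ intros w. destruct (Req_dec (Cmod w) rho) as [E|E].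
  - destruct (regular_dseqn_bound a rho f w Ha (Hreg w E)) as (K & q & d & Hq & Hd & H).
    exists (K, q, d). repeat split; auto. intros; contradiction.
  (* A centre off the circle gets half its distance to the circle as radius, so its ball stays away
     from the circle. *)
  - exists (0, 1, Rabs (Cmod w - rho) / 2).
    assert (0 < Rabs (Cmod w - rho)) by (apply Rabs_pos_lt; lra).
    repeat split; try lra. }
destruct (finite_subcover rho (fun w => snd (p w))) as [l Hl].
{ intros w. specialize (Hp w). destruct (p w) as [[K q] d]. simpl. tauto. }
destruct (list_upper_bound l (fun w => fst (fst (p w)))) as (K & HK & HKl).
destruct (list_upper_bound l (fun w => snd (fst (p w)))) as (Q & HQ & HQl).
destruct (list_upper_bound l (fun w => 4 / Rabs (Cmod w - rho))) as (B & HB & HBl).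
assert (H4Q : 0 < / (4 * Q)) by (apply Rinv_0_lt_compat; lra).
assert (HiB : 0 < / B) by (apply Rinv_0_lt_compat; lra).
(* The three bounds keep rho - eta positive, make rho - eta + / (4 * Q) exceed rho, and keep the
   circle of radius rho - eta out of the balls with centre off the circle. *)
set (eta := Rmin rho (Rmin (/ (4 * Q)) (/ B)) / 2).
assert (Heta : 0 < eta) by (unfold eta; apply Rdiv_lt_0_compat; [repeat apply Rmin_pos; lra|lra]).
assert (E1 : eta <= rho / 2) by (unfold eta; generalize (Rmin_l rho (Rmin (/ (4 * Q)) (/ B))); lra).
assert (E0 := Rmin_r rho (Rmin (/ (4 * Q)) (/ B))).
assert (E2 : eta <= / (4 * Q) / 2) by (unfold eta; generalize (Rmin_l (/ (4 * Q)) (/ B)); lra).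
assert (E3 : eta <= / B / 2) by (unfold eta; generalize (Rmin_r (/ (4 * Q)) (/ B)); lra).
exists (rho - eta + / (4 * Q)), (2 * K). split; [lra|].
apply (coeff_bound_of_dseqn a rho (rho - eta) K Q); [|lra|exact HQ|].
{ apply (absconv_of_psum a f 0). intros y Hy. apply Ha.
  replace (y - 0)%C with y in Hy by ring. exact Hy. }
intros k z v Hz Hv.
destruct (Hl z ltac:(lra)) as (t & Ht & Hzt).
specialize (Hp t). specialize (HKl t Ht). specialize (HQl t Ht). specialize (HBl t Ht).
destruct (p t) as [[Kt q] d]. simpl in *. destruct Hp as (Hq & Hd & Hfar & Hnear).
destruct (Req_dec (Cmod t) rho) as [E|E].
- eapply Rle_trans; [apply (Hnear E k z v); auto; lra|].
  assert (Hf := INR_fact_lt_0 k).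
  apply Rle_trans with (K * INR (fact k) * (2 * q) ^ k).
  + apply Rmult_le_compat_r; [apply pow_le; lra|]. apply Rmult_le_compat_r; lra.
  + apply Rmult_le_compat_l; [apply Rmult_le_pos; lra|]. apply pow_incr. lra.
(* With g the distance of t to the circle, g <= Cmod (z - t) + eta < g / 2 + g / 8, a contradiction:
   B >= 4 / g gives eta <= / B / 2 <= g / 8. *)
- exfalso. specialize (Hfar E).
  set (g := Rabs (Cmod t - rho)) in *.
  assert (Hg : 0 < g) by (apply Rabs_pos_lt; lra).
  assert (Hg2 : 4 * / B <= g).
  { apply Rmult_le_reg_r with B; [exact HB|]. rewrite Rmult_assoc, Rinv_l by lra.
    apply Rmult_le_compat_r with (r := g) in HBl; [|lra].
    unfold Rdiv in HBl. rewrite Rmult_assoc, Rinv_l in HBl by lra. lra. }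
  assert (Hg3 : g <= Cmod (z - t)%C + eta).
  { unfold g. apply Rabs_le.
    assert (T1 := Cmod_triangle (z - t)%C t). replace (z - t + t)%C with z in T1 by ring.
    assert (T2 := Cmod_triangle (- (z - t))%C z). rewrite Cmod_opp in T2.
    replace (- (z - t) + z)%C with t in T2 by ring. lra. }
  lra.
Qed.

(** * Polar terms *)

(* Coefficients of [(1 - x) ^ - M]: multiplying by [1 / (1 - x)] takes partial sums. *)
Fixpoint polar_coeff (M n : nat) : R :=
  match M with
  | O => match n with O => 1 | S _ => 0 end
  | S M' => sum_f_R0 (polar_coeff M') n
  end.

Lemma polar_coeff_nonneg (M n : nat) : 0 <= polar_coeff M n.
Proof.
revert n. induction M as [|M IH]; intros n; simpl; [destruct n; lra|].
apply cond_pos_sum. exact IH.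
Qed.

Lemma polar_coeff_1 (n : nat) : polar_coeff 1 n = 1.
Proof. induction n as [|n IH]; simpl in *; [|rewrite IH]; ring. Qed.

Lemma polar_coeff_le (M n : nat) : polar_coeff (S M) n <= (INR n + 1) ^ M.
Proof.
revert n. induction M as [|M IH]; intros n; [rewrite polar_coeff_1; simpl; lra|].
change (polar_coeff (S (S M)) n) with (sum_f_R0 (polar_coeff (S M)) n).
apply Rle_trans with (sum_f_R0 (fun _ => (INR n + 1) ^ M) n).
- apply sum_Rle. intros k Hk. eapply Rle_trans; [apply IH|].
  apply pow_incr. apply le_INR in Hk. generalize (pos_INR k). lra.
- rewrite sum_cte, S_INR. simpl. lra.
Qed.

(** A mean value bound for one unit step; summed over the steps it telescopes in
    [polar_coeff_ge]. *)
Lemma pow_succ_sub_le (x : R) (M : nat) : 0 <= x ->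
  (x + 1) ^ S M <= x ^ S M + INR (S M) * (x + 1) ^ M.
Proof.
intros Hx. induction M as [|M IH]; [simpl; lra|].
rewrite S_INR.
assert (H : 0 <= (x + 1) ^ S M) by (apply pow_le; lra).
assert (H1 : x * (x + 1) ^ S M <= x * (x ^ S M + INR (S M) * (x + 1) ^ M)) by (apply Rmult_le_compat_l; lra).
assert (H2 : 0 <= INR (S M) * (x + 1) ^ M) by (apply Rmult_le_pos; [apply pos_INR|apply pow_le; lra]).
cbn [pow] in *. lra.
Qed.

(** [polar_coeff (S M) n] is the binomial coefficient of n + M over M. With [polar_coeff_le] this
    fixes its order of growth n ^ M from both sides. *)
Lemma polar_coeff_ge (M n : nat) : (INR n + 1) ^ M <= INR (fact M) * polar_coeff (S M) n.
Proof.
revert n. induction M as [|M IH]; intros n; [rewrite polar_coeff_1; simpl; lra|].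
change (polar_coeff (S (S M)) n) with (sum_f_R0 (polar_coeff (S M)) n).
rewrite fact_simpl, mult_INR.
assert (H0 := pos_INR (S M)).
induction n as [|n IHn].
- specialize (IH 0%nat). replace (INR 0 + 1) with 1 in * by (simpl; ring).
  rewrite pow1 in *. rewrite Rmult_assoc.
  assert (1 <= INR (S M)) by (rewrite S_INR; generalize (pos_INR M); lra).
  change (sum_f_R0 (polar_coeff (S M)) 0) with (polar_coeff (S M) 0). nra.
- rewrite tech5, Rmult_plus_distr_l. rewrite S_INR at 1.
  eapply Rle_trans; [apply pow_succ_sub_le; generalize (pos_INR n); lra|].
  apply Rplus_le_compat; [exact IHn|].
  rewrite Rmult_assoc. apply Rmult_le_compat_l; [exact H0|].
  rewrite <- S_INR. apply IH.
Qed.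

Lemma polar_coeff_geometric (lam : R) (M : nat) : 1 < lam ->
  exists K, 0 <= K /\ forall n, polar_coeff M n <= K * lam ^ n.
Proof.
intros Hl. induction M as [|M (K & HK & IH)].
- exists 1. split; [lra|]. intros [|n]; [simpl; lra|].
  rewrite Rmult_1_l. apply pow_le. lra.
(* Summing lam ^ k over k <= n costs at most the factor lam / (lam - 1). *)
- exists (K * (lam / (lam - 1))).
  assert (Hd : 0 <= lam / (lam - 1)) by (apply Rlt_le, Rdiv_lt_0_compat; lra).
  split; [apply Rmult_le_pos; lra|]. intros n.
  apply Rle_trans with (sum_f_R0 (fun k => K * lam ^ k) n); [apply sum_Rle; auto|].
  induction n as [|n IHn].
  + simpl. rewrite !Rmult_1_r.
    assert (1 <= lam / (lam - 1)).
    { apply Rmult_le_reg_r with (lam - 1); [lra|]. unfold Rdiv. rewrite Rmult_assoc, Rinv_l; lra. }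
    nra.
  + rewrite tech5. eapply Rle_trans; [apply Rplus_le_compat_r, IHn|].
    right. simpl. field. lra.
Qed.

(** Differences of consecutive [polar_coeff (S M)] are [polar_coeff M], so the sum T at level S M
    satisfies T * (1 - x) = / (1 - x) ^ M. Convergence at level S M is secured beforehand by
    geometric domination. *)
Lemma polar_series (M : nat) (x : C) : Cmod x < 1 ->
  csum (fun n => (polar_coeff M n * x ^ n)%C) (/ (1 - x) ^ M)%C.
Proof.
intros Hx.
assert (Hx1 : (1 - x)%C <> 0).
{ intros E. replace x with (1 - (1 - x))%C in Hx by ring. rewrite E in Hx.
  replace (1 - 0)%C with (RtoC 1) in Hx by ring. rewrite Cmod_1 in Hx. lra. }
induction M as [|M IH].
- replace (/ (1 - x) ^ 0)%C with (polar_coeff 0 0 * x ^ 0)%C by (simpl; field; apply C1_nz).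
  apply (csum_single (fun n => (polar_coeff 0 n * x ^ n)%C)).
  intros [|k] Hk; [lia|]. simpl polar_coeff. ring.
- assert (Hmid : exists lam, 1 < lam /\ lam * Cmod x < 1).
  { exists (2 / (1 + Cmod x)). assert (H0 := Cmod_ge_0 x). split.
    - apply Rmult_lt_reg_r with (1 + Cmod x); [lra|]. unfold Rdiv. rewrite Rmult_assoc, Rinv_l; lra.
    - apply Rmult_lt_reg_r with (1 + Cmod x); [lra|].
      replace (2 / (1 + Cmod x) * Cmod x * (1 + Cmod x)) with (2 * Cmod x) by (field; lra). lra. }
  destruct Hmid as (lam & Hl1 & Hl2).
  destruct (polar_coeff_geometric lam (S M) Hl1) as (K & HK & HKn).
  destruct (csum_ex (fun n => (polar_coeff (S M) n * x ^ n)%C) (fun n => K * (lam * Cmod x) ^ n)) as [T HT].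
  { intros n. rewrite Cmod_mult, Cmod_pow, Cmod_R, Rabs_right by apply Rle_ge, polar_coeff_nonneg.
    rewrite Rpow_mult_distr, <- Rmult_assoc. apply Rmult_le_compat_r; [apply pow_le, Cmod_ge_0|apply HKn]. }
  { apply (ex_series_scal (K := R_AbsRing) (V := R_NormedModule) K (fun n => (lam * Cmod x) ^ n)).
    exists (/ (1 - lam * Cmod x)). apply is_series_geom.
    rewrite Rabs_right; [exact Hl2|]. apply Rle_ge, Rmult_le_pos; [lra|apply Cmod_ge_0]. }
  assert (H1 := csum_minus _ _ _ _ (csum_tail _ _ HT) (csum_scal x _ _ HT)).
  assert (H2 := csum_tail _ _ IH). cbv beta in H1, H2.
  assert (E : (T - polar_coeff (S M) 0 * x ^ 0 - x * T)%C = (/ (1 - x) ^ M - polar_coeff M 0 * x ^ 0)%C).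
  { apply (csum_unique _ _ _ H1). eapply csum_ext; [|exact H2].
    intros n. cbv beta.
    change (polar_coeff (S M) (S n)) with (polar_coeff (S M) n + polar_coeff M (S n)).
    rewrite RtoC_plus, Cpow_S. ring. }
  change (polar_coeff (S M) 0) with (polar_coeff M 0) in E.
  replace (/ (1 - x) ^ S M)%C with T; [exact HT|].
  assert (E' : (T * (1 - x))%C = (/ (1 - x) ^ M)%C).
  { replace (T * (1 - x))%C with (T - polar_coeff M 0 * x ^ 0 - x * T + polar_coeff M 0 * x ^ 0)%C by ring.
    rewrite E. ring. }
  replace T with (T * (1 - x) * / (1 - x))%C by (field; exact Hx1).
  rewrite E', Cpow_S. field. split; [apply Cpow_nz, Hx1|exact Hx1].
Qed.

(** Normalized to be 1 at the origin, so that its coefficients there are [polar_coeff M n] times (/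
    alpha) ^ n. *)
Definition polar (alpha : C) (M : nat) (z : C) : C := (/ (1 - z * / alpha) ^ M)%C.

Lemma polar_psum_0 (alpha : C) (M : nat) (z : C) : alpha <> 0 -> Cmod z < Cmod alpha ->
  psum (fun n => (polar_coeff M n * (/ alpha) ^ n)%C) 0 z (polar alpha M z).
Proof.
intros Ha Hz. unfold psum, polar.
eapply csum_ext; [|apply polar_series].
- intros n. cbv beta. rewrite Cpow_mult_l. replace (z - 0)%C with z by ring. ring.
- assert (Hp := proj1 (Cmod_gt_0 alpha) Ha).
  rewrite Cmod_mult, Cmod_inv by exact Ha.
  apply Rmult_lt_reg_r with (Cmod alpha); [exact Hp|]. rewrite Rmult_assoc, Rinv_l; lra.
Qed.

(** Recentring at w: with mu = alpha - w, 1 - z / alpha = (mu / alpha) * (1 - (z - w) / mu), so the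
    expansion at w is again a polar one, of radius Cmod mu. *)
Lemma polar_regular_at (rho : R) (alpha w : C) (M : nat) : alpha <> 0 -> alpha <> w ->
  regular_at rho (polar alpha M) w.
Proof.
intros Ha Hw.
set (mu := (alpha - w)%C).
assert (Hmu : mu <> 0).
{ unfold mu. intros E. apply Hw. replace alpha with (alpha - w + w)%C by ring. rewrite E. ring. }
assert (Hp := proj1 (Cmod_gt_0 mu) Hmu).
exists (fun n => ((alpha / mu) ^ M * (polar_coeff M n * (/ mu) ^ n))%C). split.
- destruct (polar_coeff_geometric 2 M ltac:(lra)) as (K & HK & HKn).
  exists (Cmod (alpha / mu) ^ M * K), (2 * / Cmod mu). split.
  + apply Rmult_lt_0_compat; [lra|apply Rinv_0_lt_compat, Hp].
  + intros n. rewrite !Cmod_mult, !Cmod_pow, (Cmod_inv mu Hmu), Cmod_R, Rabs_right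
      by apply Rle_ge, polar_coeff_nonneg.
    rewrite Rpow_mult_distr, Rmult_assoc. apply Rmult_le_compat_l; [apply pow_le, Cmod_ge_0|].
    rewrite <- Rmult_assoc. apply Rmult_le_compat_r; [|apply HKn].
    apply pow_le, Rlt_le, Rinv_0_lt_compat, Hp.
- exists (Cmod mu). split; [exact Hp|]. intros z _ Hz.
  assert (H := polar_psum_0 mu M (z - w)%C Hmu Hz).
  apply (csum_scal ((alpha / mu) ^ M)%C) in H.
  unfold psum.
  assert (Hnz : (1 - (z - w) * / mu)%C <> 0).
  { intros E. assert (E2 : (z - w)%C = mu).
    { replace (z - w)%C with (mu - (1 - (z - w) * / mu) * mu)%C by (field; exact Hmu). rewrite E. ring. }
    rewrite E2 in Hz. lra. }
  replace (polar alpha M z) with ((alpha / mu) ^ M * polar mu M (z - w))%C.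
  + eapply csum_ext; [|exact H]. intros n. cbv beta.
    replace (z - w - 0)%C with (z - w)%C by ring. ring.
  + unfold polar.
    replace (1 - z * / alpha)%C with ((1 - (z - w) * / mu) * (mu / alpha))%C.
    2: { unfold mu. field. split; [exact Ha|exact Hmu]. }
    rewrite Cpow_mult_l.
    assert (PQ : ((alpha / mu) ^ M * (mu / alpha) ^ M = 1)%C).
    { rewrite <- Cpow_mult_l. replace (alpha / mu * (mu / alpha))%C with (RtoC 1).
      - apply Cpow_1_l.
      - field. split; [exact Ha|exact Hmu]. }
    assert (HA := Cpow_nz _ M Hnz).
    set (A := ((1 - (z - w) * / mu) ^ M)%C) in *.
    set (Q := ((mu / alpha) ^ M)%C) in *.
    assert (HQ : Q <> 0).
    { intros E. rewrite E, Cmult_0_r in PQ. apply C1_nz. symmetry. exact PQ. }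
    transitivity ((alpha / mu) ^ M * Q * / (A * Q))%C.
    * field. split; [exact HQ|exact HA].
    * rewrite PQ. ring.
Qed.

(** * Growth of the coefficients *)

Lemma local_series_ext (rho : R) (g h : C -> C) (w : C) (c : nat -> C) :
  (forall z, Cmod z < rho -> g z = h z) -> local_series rho g w c -> local_series rho h w c.
Proof.
intros E [Hc (r & Hr & H)]. split; [exact Hc|]. exists r. split; [exact Hr|].
intros z Hz Hzw. rewrite <- E by exact Hz. apply H; assumption.
Qed.

Lemma regular_at_ext (rho : R) (g h : C -> C) (w : C) :
  (forall z, Cmod z < rho -> g z = h z) -> regular_at rho g w -> regular_at rho h w.
Proof. intros E [c Hc]. exists c. exact (local_series_ext rho g h w c E Hc). Qed.

Lemma psum_sub_scal (c c' : nat -> C) (k w z v v' : C) :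
  psum c w z v -> psum c' w z v' -> psum (fun n => (c n - k * c' n)%C) w z (v - k * v')%C.
Proof.
intros H H'. unfold psum.
eapply csum_ext; [|exact (csum_minus _ _ _ _ H (csum_scal k _ _ H'))].
intros n. cbv beta. ring.
Qed.

Lemma local_series_sub_scal (rho : R) (g g' : C -> C) (k w : C) (c c' : nat -> C) :
  local_series rho g w c -> local_series rho g' w c' ->
  local_series rho (fun z => (g z - k * g' z)%C) w (fun n => (c n - k * c' n)%C).
Proof.
intros [(K & q & Hq & Hc) (r & Hr & H)] [(K' & q' & Hq' & Hc') (r' & Hr' & H')].
assert (HK : 0 <= K) by (generalize (Hc 0%nat) (Cmod_ge_0 (c 0%nat)); simpl; lra).
assert (HK' : 0 <= K') by (generalize (Hc' 0%nat) (Cmod_ge_0 (c' 0%nat)); simpl; lra).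
split.
- exists (K + Cmod k * K'), (Rmax q q'). split; [eapply Rlt_le_trans; [exact Hq|apply Rmax_l]|].
  intros n. unfold Cminus. eapply Rle_trans; [apply Cmod_triangle|].
  rewrite Cmod_opp, Cmod_mult, Rmult_plus_distr_r. apply Rplus_le_compat.
  + eapply Rle_trans; [apply Hc|]. apply Rmult_le_compat_l; [exact HK|].
    apply pow_incr. split; [lra|apply Rmax_l].
  + rewrite Rmult_assoc. apply Rmult_le_compat_l; [apply Cmod_ge_0|].
    eapply Rle_trans; [apply Hc'|]. apply Rmult_le_compat_l; [exact HK'|].
    apply pow_incr. split; [lra|apply Rmax_r].
- exists (Rmin r r'). split; [apply Rmin_pos; assumption|].
  intros z Hz Hzw. apply psum_sub_scal.
  + apply H; [exact Hz|]. eapply Rlt_le_trans; [exact Hzw|apply Rmin_l].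
  + apply H'; [exact Hz|]. eapply Rlt_le_trans; [exact Hzw|apply Rmin_r].
Qed.

(** Coefficients, in powers of z - w, of the series times g + (z - w); taking g = w - b gives
    multiplication by z - b. *)
Definition mul_linear (g : C) (c : nat -> C) (n : nat) : C :=
  match n with O => (g * c 0%nat)%C | S m => (c m + g * c (S m))%C end.

Lemma psum_mul_linear (c : nat -> C) (w z v b : C) :
  psum c w z v -> psum (mul_linear (w - b)%C c) w z ((z - b) * v)%C.
Proof.
intros H.
assert (H1 := csum_tail _ _ H).
assert (H2 := csum_plus _ _ _ _ (csum_scal (z - w)%C _ _ H) (csum_scal (w - b)%C _ _ H1)).
cbv beta in H2.
unfold psum. replace ((z - b) * v)%C with
  ((z - w) * v + (w - b) * (v - c 0%nat * (z - w) ^ 0) + mul_linear (w - b) c 0 * (z - w) ^ 0)%C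
  by (simpl; ring).
apply (csum_cons (fun n => (mul_linear (w - b) c n * (z - w) ^ n)%C)).
eapply csum_ext; [|exact H2].
intros n. cbv beta. simpl mul_linear. rewrite Cpow_S. ring.
Qed.

Lemma local_series_mul_linear (rho : R) (g : C -> C) (w b : C) (c : nat -> C) :
  local_series rho g w c ->
  local_series rho (fun z => ((z - b) * g z)%C) w (mul_linear (w - b)%C c).
Proof.
intros [(K & q & Hq & Hc) (r & Hr & H)].
assert (HK : 0 <= K) by (generalize (Hc 0%nat) (Cmod_ge_0 (c 0%nat)); simpl; lra).
split.
- exists (K * (/ q + Cmod (w - b)%C)), q. split; [exact Hq|].
  assert (Hi : 0 < / q) by (apply Rinv_0_lt_compat, Hq).
  assert (Hg := Cmod_ge_0 (w - b)%C).
  intros [|n]; simpl mul_linear.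
  + rewrite Cmod_mult. specialize (Hc 0%nat). simpl in *.
    assert (Cmod (w - b)%C * Cmod (c 0%nat) <= Cmod (w - b)%C * K) by (apply Rmult_le_compat_l; lra).
    assert (0 <= K * / q) by (apply Rmult_le_pos; lra). lra.
  + eapply Rle_trans; [apply Cmod_triangle|]. rewrite Cmod_mult.
    replace (K * (/ q + Cmod (w - b)%C) * q ^ S n) with (K * q ^ n + Cmod (w - b)%C * (K * q ^ S n))
      by (simpl; field; lra).
    apply Rplus_le_compat; [apply Hc|]. apply Rmult_le_compat_l; [exact Hg|apply Hc].
- exists r. split; [exact Hr|]. intros z Hz Hzw. apply psum_mul_linear, H; assumption.
Qed.

Lemma regular_at_mul_linear (rho : R) (g : C -> C) (w b : C) :
  regular_at rho g w -> regular_at rho (fun z => ((z - b) * g z)%C) w.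
Proof. intros [c Hc]. eexists. apply local_series_mul_linear, Hc. Qed.

Lemma regular_at_mul_pow (rho : R) (g : C -> C) (w b : C) (M : nat) :
  regular_at rho g w -> regular_at rho (fun z => ((z - b) ^ M * g z)%C) w.
Proof.
intros H. induction M as [|M IH].
- apply regular_at_ext with g; [|exact H]. intros z _. simpl. ring.
- apply regular_at_ext with (fun z => ((z - b) * ((z - b) ^ M * g z))%C).
  + intros z _. rewrite Cpow_S. ring.
  + apply regular_at_mul_linear, IH.
Qed.

Lemma local_series_const (rho : R) (k w : C) :
  local_series rho (fun _ => k) w (fun n => match n with O => k | S _ => RtoC 0 end).
Proof.
split.
- exists (Cmod k), 1. split; [lra|]. intros [|n]; rewrite pow1, Rmult_1_r; [lra|].
  rewrite Cmod_0. apply Cmod_ge_0.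
- exists 1. split; [lra|]. intros z _ _. unfold psum.
  set (c := fun n : nat => match n with O => k | S _ => RtoC 0 end).
  assert (H := csum_single (fun n => (c n * (z - w) ^ n)%C) 0).
  simpl in H. rewrite Cmult_1_r in H. apply H.
  intros [|n] Hn; [lia|]. simpl. ring.
Qed.

(** A vanishing constant term lets z - w be divided out; rho <= Cmod w makes z - w nonzero at every
    point where the local series is tested. *)
Lemma local_series_div_linear (rho : R) (h : C -> C) (w : C) (c : nat -> C) :
  rho <= Cmod w -> c 0%nat = RtoC 0 ->
  local_series rho (fun z => ((z - w) * h z)%C) w c ->
  local_series rho h w (fun n => c (S n)).
Proof.
intros Hw H0 [(K & q & Hq & Hc) (r & Hr & H)]. split.
- exists (K * q), q. split; [exact Hq|]. intros n. rewrite Rmult_assoc. apply Hc.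
- exists r. split; [exact Hr|]. intros z Hz Hzw.
  assert (Hnz : (z - w)%C <> 0).
  { intros E. replace z with (z - w + w)%C in Hz by ring. rewrite E, Cplus_0_l in Hz. lra. }
  assert (H1 := csum_scal (/ (z - w))%C _ _ (csum_tail _ _ (H z Hz Hzw))). cbv beta in H1.
  rewrite H0 in H1. unfold psum.
  replace (h z) with (/ (z - w) * ((z - w) * h z - 0 * (z - w) ^ 0))%C by (simpl; field; exact Hnz).
  eapply csum_ext; [|exact H1]. intros n. cbv beta. rewrite Cpow_S. field. exact Hnz.
Qed.

Lemma polar_mul_pow (alpha z : C) (M : nat) : alpha <> 0 -> z <> alpha ->
  ((z - alpha) ^ M * polar alpha M z = (- alpha) ^ M)%C.
Proof.
intros Ha Hz. unfold polar.
assert (Hna : (- alpha)%C <> 0).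
{ intros E. apply Ha. replace alpha with (- - alpha)%C by ring. rewrite E. ring. }
assert (Hza : (z - alpha)%C <> 0).
{ intros E. apply Hz. replace z with (z - alpha + alpha)%C by ring. rewrite E. ring. }
assert (HA : (1 - z * / alpha)%C <> 0).
{ intros E. apply Hza. replace (z - alpha)%C with (- alpha * (1 - z * / alpha))%C by (field; exact Ha).
  rewrite E. ring. }
replace (z - alpha)%C with (- alpha * (1 - z * / alpha))%C by (field; exact Ha).
rewrite Cpow_mult_l. field. apply Cpow_nz, HA.
Qed.

Lemma neq_of_Cmod_lt (z w : C) (rho : R) : Cmod z < rho -> rho <= Cmod w -> z <> w.
Proof. intros H1 H2 E. subst. lra. Qed.

(* The leading term of the principal part at a pole [alpha] of order [S M] is the multiple of
   [1 / (z - alpha) ^ (S M)] by the constant term [c 0] of [(z - alpha) ^ S M * f z]. *)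
Lemma subtract_leading_polar (rho : R) (f : C -> C) (alpha : C) (M : nat) (c : nat -> C) :
  0 < rho -> Cmod alpha = rho ->
  local_series rho (fun z => ((z - alpha) ^ S M * f z)%C) alpha c ->
  regular_at rho (fun z => ((z - alpha) ^ M *
    (f z - c 0%nat * / (- alpha) ^ S M * polar alpha (S M) z))%C) alpha.
Proof.
intros Hrho Ha Hc.
assert (Hnz : alpha <> 0) by (intros E; rewrite E, Cmod_0 in Ha; lra).
assert (Hna : (- alpha)%C <> 0).
{ intros E. apply Hnz. replace alpha with (- - alpha)%C by ring. rewrite E. ring. }
(* Subtracting the polar term removes exactly the constant c 0 from the expansion of (z - alpha) ^ S
   M * f z. The factor 1 fits the form of [local_series_sub_scal]. *)
eexists. apply local_series_div_linear with
  (c := fun n => (c n - 1 * match n with O => c 0%nat | S _ => RtoC 0 end)%C); [lra| |].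
- simpl. ring.
- apply local_series_ext with (fun z => ((z - alpha) ^ S M * f z - 1 * c 0%nat)%C).
  + intros z Hz.
    transitivity ((z - alpha) ^ S M * f z - c 0%nat * / (- alpha) ^ S M * ((z - alpha) ^ S M * polar alpha (S M) z))%C.
    * rewrite polar_mul_pow; [|exact Hnz|apply (neq_of_Cmod_lt z alpha rho); lra].
      field. apply Cpow_nz, Hna.
    * rewrite (Cpow_S (z - alpha)). ring.
  + apply (local_series_sub_scal rho _ (fun _ => c 0%nat) 1 alpha c); [exact Hc|].
    apply local_series_const.
Qed.

Lemma Cmod_polar_coeff_scaled (alpha k : C) (rho : R) (M n : nat) : 0 < rho -> Cmod alpha = rho ->
  Cmod (k * (polar_coeff (S M) n * (/ alpha) ^ n))%C * rho ^ n = Cmod k * polar_coeff (S M) n.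
Proof.
intros Hrho Ha.
assert (Hnz : alpha <> 0) by (intros E; rewrite E, Cmod_0 in Ha; lra).
rewrite !Cmod_mult, Cmod_pow, Cmod_inv, Ha, Cmod_R, Rabs_right
  by (first [exact Hnz|apply Rle_ge, polar_coeff_nonneg]).
rewrite pow_inv. field. apply pow_nonzero. lra.
Qed.

(** INR n + 1 is [polar_coeff 2 n], which grows more slowly than (r / rho) ^ n. *)
Lemma linear_geometric_bounded (r rho : R) : 0 < rho < r ->
  exists K, 0 <= K /\ forall n, (INR n + 1) * rho ^ n <= K * r ^ n.
Proof.
intros H. destruct (polar_coeff_geometric (r / rho) 2) as (K & HK & HKn).
{ apply Rmult_lt_reg_r with rho; [lra|]. unfold Rdiv. rewrite Rmult_assoc, Rinv_l; lra. }
exists K. split; [exact HK|]. intros n. specialize (HKn n).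
replace (polar_coeff 2 n) with (INR n + 1) in HKn.
- apply Rmult_le_compat_r with (r := rho ^ n) in HKn; [|apply pow_le; lra].
  unfold Rdiv in HKn. rewrite Rpow_mult_distr, pow_inv in HKn.
  replace (K * (r ^ n * / rho ^ n) * rho ^ n) with (K * r ^ n) in HKn
    by (field; apply pow_nonzero; lra). exact HKn.
- change (polar_coeff 2 n) with (sum_f_R0 (polar_coeff 1) n).
  rewrite (sum_eq _ (fun _ => 1)) by (intros; apply polar_coeff_1).
  rewrite sum_cte, S_INR. ring.
Qed.

Definition order_le (rho : R) (l : list C) (M : nat) (f : C -> C) : Prop :=
  (forall w, Cmod w = rho -> ~ In w l -> regular_at rho f w) /\
  (forall w, In w l -> Cmod w = rho /\ regular_at rho (fun z => ((z - w) ^ M * f z)%C) w).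

(** A polar term at alpha leaves the order at any other point w unchanged. With N = 0, g can be f
    itself, which covers the regular points. *)
Lemma regular_at_sub_polar (rho : R) (f g : C -> C) (w alpha k : C) (N M : nat) :
  alpha <> 0 -> alpha <> w ->
  (forall z, g z = ((z - w) ^ N * f z)%C) ->
  regular_at rho g w ->
  regular_at rho (fun z => ((z - w) ^ N * (f z - k * polar alpha M z))%C) w.
Proof.
intros Ha Hw E [c Hc].
destruct (regular_at_mul_pow rho _ w w N (polar_regular_at rho alpha w M Ha Hw)) as [c' Hc'].
eexists. eapply local_series_ext; [|exact (local_series_sub_scal rho _ _ k w c c' Hc Hc')].
intros z _. cbv beta. rewrite E. ring.
Qed.

(** The factor INR n + 1 on the left expresses the exponent M - 1 without subtraction; for M = 0 it
    asks for decay like 1 / n, which the larger radius supplies. *)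
Lemma coeff_growth (rho : R) (l : list C) (M : nat) : 0 < rho ->
  forall (a : nat -> C) (f : C -> C), (forall z, Cmod z < rho -> psum a 0 z (f z)) ->
  order_le rho l M f ->
  exists K, forall n, Cmod (a n) * rho ^ n * (INR n + 1) <= K * (INR n + 1) ^ M.
Proof.
intros Hrho. induction M as [|M IH]; intros a f Ha [Hreg Hl].
- destruct (coeff_decay_of_regular a rho f Hrho Ha) as (r & K & Hr & HK).
  { intros w Hw. destruct (classic (In w l)) as [Hin|Hin]; [|apply Hreg; assumption].
    apply regular_at_ext with (fun z => ((z - w) ^ 0 * f z)%C); [intros; simpl; ring|].
    apply Hl, Hin. }
  destruct (linear_geometric_bounded r rho ltac:(lra)) as (K' & HK' & HKn').
  exists (K * K'). intros n. simpl. rewrite Rmult_1_r.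
  replace (Cmod (a n) * rho ^ n * (INR n + 1)) with (Cmod (a n) * ((INR n + 1) * rho ^ n)) by ring.
  eapply Rle_trans; [apply Rmult_le_compat_l; [apply Cmod_ge_0|apply HKn']|].
  replace (Cmod (a n) * (K' * r ^ n)) with (Cmod (a n) * r ^ n * K') by ring.
  apply Rmult_le_compat_r; [exact HK'|apply HK].
(* Inner induction: l' contains the points of l whose order has not yet been lowered from S M to M.
   Each step treats its head, and for empty l' the outer induction hypothesis applies. *)
- assert (Hgen : forall l' : list C, forall (a : nat -> C) (f : C -> C),
    (forall z, Cmod z < rho -> psum a 0 z (f z)) ->
    (forall w, Cmod w = rho -> ~ In w l -> regular_at rho f w) ->
    (forall w, In w l -> Cmod w = rho /\ regular_at rho (fun z => ((z - w) ^ S M * f z)%C) w) ->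
    (forall w, In w l -> ~ In w l' -> regular_at rho (fun z => ((z - w) ^ M * f z)%C) w) ->
    exists K, forall n, Cmod (a n) * rho ^ n * (INR n + 1) <= K * (INR n + 1) ^ S M).
  { clear a f Ha Hreg Hl. induction l' as [|alpha l' IHl]; intros a f Ha Hreg Hl Hl'.
    - destruct (IH a f Ha) as [K HK].
      { split; [exact Hreg|]. intros w Hw. split; [apply Hl, Hw|]. apply Hl'; [exact Hw|intros []]. }
      exists (Rmax 0 K). intros n. eapply Rle_trans; [apply HK|].
      assert (Hn : 0 <= INR n) by apply pos_INR.
      assert (Hp : 0 <= (INR n + 1) ^ M) by (apply pow_le; lra).
      assert (H0 := Rmax_l 0 K). assert (H1 := Rmax_r 0 K).
      simpl. apply Rle_trans with (Rmax 0 K * (INR n + 1) ^ M); [apply Rmult_le_compat_r; lra|].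
      apply Rmult_le_compat_l; [lra|]. nra.
    - destruct (classic (In alpha l)) as [Hin|Hin].
      2: { apply (IHl a f Ha Hreg Hl). intros w Hw Hwl. apply Hl'; [exact Hw|].
           intros [E|E]; [subst; contradiction|contradiction]. }
      destruct (Hl alpha Hin) as [Hal [c Hc]].
      assert (Hnz : alpha <> 0) by (intros E; rewrite E, Cmod_0 in Hal; lra).
      set (k := (c 0%nat * / (- alpha) ^ S M)%C).
      destruct (IHl (fun n => (a n - k * (polar_coeff (S M) n * (/ alpha) ^ n))%C)
                    (fun z => (f z - k * polar alpha (S M) z)%C)) as [K HK].
      + intros z Hz. apply psum_sub_scal; [apply Ha, Hz|].
        apply polar_psum_0; [exact Hnz|lra].
      + intros w Hw Hwl.
        apply regular_at_ext with (fun z => ((z - w) ^ 0 * (f z - k * polar alpha (S M) z))%C);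
          [intros; simpl; ring|].
        apply regular_at_sub_polar with f; [exact Hnz|intros E; subst; contradiction| |apply Hreg; assumption].
        intros; simpl; ring.
      + intros w Hw. split; [apply Hl, Hw|].
        destruct (classic (alpha = w)) as [E|E].
        * subst w.
          apply regular_at_ext with (fun z => ((z - alpha) * ((z - alpha) ^ M * (f z - k * polar alpha (S M) z)))%C).
          { intros z _. rewrite Cpow_S. ring. }
          apply regular_at_mul_linear. apply subtract_leading_polar with (1 := Hrho); assumption.
        * apply regular_at_sub_polar with (fun z => ((z - w) ^ S M * f z)%C);
            [exact Hnz|exact E|reflexivity|apply Hl, Hw].
      + intros w Hw Hwl.
        destruct (classic (alpha = w)) as [E|E].
        * subst w. apply subtract_leading_polar with (1 := Hrho); assumption.
        * apply regular_at_sub_polar with (fun z => ((z - w) ^ M * f z)%C);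
            [exact Hnz|exact E|reflexivity|]. apply Hl'; [exact Hw|].
          intros [E'|E']; contradiction.
      (* The subtracted coefficients contribute Cmod k * (INR n + 1) ^ M, by [polar_coeff_le]. *)
      + exists (K + Cmod k). intros n.
        set (p := (k * (polar_coeff (S M) n * (/ alpha) ^ n))%C) in *.
        specialize (HK n). cbv beta in HK. fold p in HK.
        assert (Hp : Cmod p * rho ^ n <= Cmod k * (INR n + 1) ^ M).
        { unfold p. rewrite (Cmod_polar_coeff_scaled alpha k rho M n Hrho Hal).
          apply Rmult_le_compat_l; [apply Cmod_ge_0|apply polar_coeff_le]. }
        assert (Hn : 0 <= INR n) by apply pos_INR.
        apply Rmult_le_compat_r with (r := INR n + 1) in Hp; [|lra].
        assert (Ht := Cmod_triangle (a n - p)%C p).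
        replace (a n - p + p)%C with (a n) in Ht by ring.
        apply Rmult_le_compat_r with (r := rho ^ n * (INR n + 1)) in Ht.
        2: { apply Rmult_le_pos; [apply pow_le; lra|lra]. }
        simpl in *. lra. }
  apply (Hgen l a f Ha Hreg Hl). intros; contradiction.
Qed.

(** * Windows of consecutive coefficients *)

Definition root_prod (l : list C) (z : C) : C :=
  fold_right (fun b p => ((z - b) * p)%C) (RtoC 1) l.

Definition mul_roots (l : list C) (a : nat -> C) : nat -> C :=
  fold_right (fun b c => mul_linear (0 - b)%C c) a l.

Lemma root_prod_app (l1 l2 : list C) (z : C) :
  root_prod (l1 ++ l2) z = (root_prod l1 z * root_prod l2 z)%C.
Proof. induction l1 as [|b l1 IH]; simpl; [|rewrite IH]; ring. Qed.

Lemma root_prod_neq_0 (l : list C) (z : C) : ~ In z l -> root_prod l z <> 0.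
Proof.
induction l as [|b l IH]; simpl; intros H; [apply C1_nz|].
apply Cmult_neq_0; [|apply IH; tauto].
intros E. apply H. left. replace z with (z - b + b)%C by ring. rewrite E. ring.
Qed.

Lemma psum_mul_roots (l : list C) (a : nat -> C) (z v : C) :
  psum a 0 z v -> psum (mul_roots l a) 0 z (root_prod l z * v)%C.
Proof.
intros H. induction l as [|b l IH]; simpl.
- replace (1 * v)%C with v by ring. exact H.
- replace ((z - b) * root_prod l z * v)%C with ((z - b) * (root_prod l z * v))%C by ring.
  apply psum_mul_linear. exact IH.
Qed.

(** The constant term is tracked because, at a pole outside l, it must stay nonzero for the order to
    be preserved. *)
Lemma local_series_mul_roots (rho : R) (l : list C) (g : C -> C) (w : C) (c : nat -> C) :
  local_series rho g w c -> exists c', c' 0%nat = (root_prod l w * c 0%nat)%C /\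
    local_series rho (fun z => (root_prod l z * g z)%C) w c'.
Proof.
intros H. induction l as [|b l (c' & E & IH)].
- exists c. split; [simpl; ring|].
  apply local_series_ext with g; [intros; simpl; ring|exact H].
- exists (mul_linear (w - b)%C c'). split; [simpl; rewrite E; ring|].
  apply local_series_ext with (fun z => ((z - b) * (root_prod l z * g z))%C); [intros; simpl; ring|].
  apply local_series_mul_linear, IH.
Qed.

Lemma regular_at_mul_roots (rho : R) (l : list C) (g : C -> C) (w : C) :
  regular_at rho g w -> regular_at rho (fun z => (root_prod l z * g z)%C) w.
Proof.
intros [c Hc]. destruct (local_series_mul_roots rho l g w c Hc) as (c' & _ & H).
exists c'. exact H.
Qed.

Lemma regular_at_mul_own_root (rho : R) (l : list C) (f : C -> C) (w : C) (m : nat) : In w l ->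
  regular_at rho (fun z => ((z - w) ^ S m * f z)%C) w ->
  regular_at rho (fun z => ((z - w) ^ m * (root_prod l z * f z))%C) w.
Proof.
intros Hw H. destruct (in_split w l Hw) as (l1 & l2 & ->).
apply regular_at_ext with (fun z => (root_prod (l1 ++ l2) z * ((z - w) ^ S m * f z))%C).
- intros z _. rewrite !root_prod_app, Cpow_S. simpl. ring.
- apply regular_at_mul_roots, H.
Qed.

(** Each factor combines two neighbouring coefficients with weights 1 and -b, at a cost of 1 + rho.
    Coefficient n + length l thus involves only a n, ..., a (n + length l). *)
Lemma Cmod_mul_roots_le (rho : R) (l : list C) (a : nat -> C) (E : R) (n : nat) : 0 <= rho ->
  (forall b, In b l -> Cmod b = rho) ->
  (forall j, (n <= j <= n + length l)%nat -> Cmod (a j) <= E) ->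
  Cmod (mul_roots l a (n + length l)) <= (1 + rho) ^ length l * E.
Proof.
intros Hrho. revert n. induction l as [|b l IH]; intros n Hl Ha.
- simpl in *. rewrite Rmult_1_l. apply Ha. lia.
- simpl length in *. rewrite Nat.add_succ_r. simpl mul_roots. simpl mul_linear.
  assert (H1 := IH n (fun b Hb => Hl b (or_intror Hb)) ltac:(intros j Hj; apply Ha; lia)).
  assert (H2 := IH (S n) (fun b Hb => Hl b (or_intror Hb)) ltac:(intros j Hj; apply Ha; lia)).
  eapply Rle_trans; [apply Cmod_triangle|]. rewrite Cmod_mult.
  replace (0 - b)%C with (- b)%C by ring. rewrite Cmod_opp, (Hl b (or_introl eq_refl)).
  simpl pow. change (S n + length l)%nat with (S (n + length l)) in H2.
  fold (mul_roots l a).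
  apply Rmult_le_compat_l with (r := rho) in H2; [|exact Hrho]. lra.
Qed.

(** After subtraction of the leading polar term at alpha, the product with [root_prod l] has order
    at most m everywhere, so by [coeff_growth] its coefficients are smaller by a factor n than those
    of the polar term. *)
Lemma dominant_pole_lower_bound (rho : R) (l : list C) (a : nat -> C) (f : C -> C)
  (alpha : C) (m : nat) (c : nat -> C) : 0 < rho ->
  (forall z, Cmod z < rho -> psum a 0 z (f z)) ->
  Cmod alpha = rho -> ~ In alpha l ->
  order_le rho (alpha :: l) (S m) f ->
  local_series rho (fun z => ((z - alpha) ^ S m * f z)%C) alpha c -> c 0%nat <> 0 ->
  exists kap N, 0 < kap /\ forall n, (N <= n)%nat -> kap <= Cmod (mul_roots l a n) * rho ^ n.
Proof.
intros Hrho Ha Hal Hnin [Hreg Hord] Hc Hc0.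
assert (Hnz : alpha <> 0) by (intros E; rewrite E, Cmod_0 in Hal; lra).
assert (Hna : (- alpha)%C <> 0).
{ intros E. apply Hnz. replace alpha with (- - alpha)%C by ring. rewrite E. ring. }
destruct (local_series_mul_roots rho l _ _ _ Hc) as (d & Hd0 & Hd).
apply local_series_ext with (h := fun z => ((z - alpha) ^ S m * (root_prod l z * f z))%C) in Hd;
  [|intros; ring].
set (k := (d 0%nat * / (- alpha) ^ S m)%C).
assert (Hk : 0 < Cmod k).
{ apply Cmod_gt_0. unfold k. rewrite Hd0. repeat apply Cmult_neq_0; auto.
  - apply root_prod_neq_0, Hnin.
  - intros E. apply C1_nz. rewrite <- (Cinv_r ((- alpha) ^ S m)%C) by apply Cpow_nz, Hna.
    rewrite E. ring. }
set (u := mul_roots l a).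
set (q := fun n => (k * (polar_coeff (S m) n * (/ alpha) ^ n))%C).
destruct (coeff_growth rho (alpha :: l) m Hrho (fun n => (u n - q n)%C)
  (fun z => (root_prod l z * f z - k * polar alpha (S m) z)%C)) as [K HK].
{ intros z Hz. apply psum_sub_scal; [apply psum_mul_roots, Ha, Hz|].
  apply polar_psum_0; [exact Hnz|lra]. }
{ split.
  - intros w Hw Hwl.
    apply regular_at_ext with (fun z => ((z - w) ^ 0 * (root_prod l z * f z - k * polar alpha (S m) z))%C);
      [intros; simpl; ring|].
    apply (regular_at_sub_polar rho _ (fun z => (root_prod l z * f z)%C)); [exact Hnz| | |].
    + intros E. apply Hwl. left. exact E.
    + intros; simpl; ring.
    + apply regular_at_mul_roots, Hreg; assumption.
  - intros w Hw. split; [apply Hord, Hw|].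
    destruct (classic (alpha = w)) as [<-|E].
    + apply subtract_leading_polar with (1 := Hrho); assumption.
    + apply (regular_at_sub_polar rho _ (fun z => ((z - w) ^ m * (root_prod l z * f z))%C));
        [exact Hnz|exact E|reflexivity|].
      apply regular_at_mul_own_root; [|apply Hord, Hw].
      destruct Hw as [E'|Hw]; [contradiction|exact Hw]. }
assert (Hf := INR_fact_lt_0 m).
(* The main term is at least 2 * kap * (INR n + 1) ^ m by [polar_coeff_ge]; for n >= N > K / kap the
   remainder takes away at most half of it. *)
set (kap := Cmod k / (2 * INR (fact m))).
assert (Hkap : 0 < kap) by (apply Rdiv_lt_0_compat; lra).
assert (Hkap2 : kap * (2 * INR (fact m)) = Cmod k) by (unfold kap; field; lra).
destruct (INR_unbounded (K / kap)) as [N HN].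
exists kap, N. split; [exact Hkap|]. intros n Hn.
assert (Hn1 : K <= kap * (INR n + 1)).
{ apply le_INR in Hn. apply Rmult_le_reg_r with (/ kap); [apply Rinv_0_lt_compat, Hkap|].
  replace (kap * (INR n + 1) * / kap) with (INR n + 1) by (field; lra).
  unfold Rdiv in HN. lra. }
assert (Hn0 : 0 <= INR n) by apply pos_INR.
assert (Hpw : 1 <= (INR n + 1) ^ m) by (apply pow_R1_Rle; lra).
specialize (HK n). cbv beta in HK.
assert (Hq : Cmod (q n) * rho ^ n = Cmod k * polar_coeff (S m) n)
  by (apply Cmod_polar_coeff_scaled; assumption).
assert (Hge := polar_coeff_ge m n).
assert (Ht := Cmod_triangle (u n) (- (u n - q n))%C). rewrite Cmod_opp in Ht.
replace (u n + - (u n - q n))%C with (q n) in Ht by ring.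
assert (Hr : 0 < rho ^ n) by (apply pow_lt; lra).
apply Rmult_le_compat_r with (r := rho ^ n) in Ht; [|lra].
assert (Hlow : 2 * kap * (INR n + 1) ^ m <= Cmod (q n) * rho ^ n).
{ rewrite Hq, <- Hkap2. apply Rmult_le_compat_l with (r := 2 * kap) in Hge; lra. }
assert (Hup : Cmod (u n - q n)%C * rho ^ n <= kap * (INR n + 1) ^ m).
{ apply Rmult_le_reg_r with (INR n + 1); [lra|]. eapply Rle_trans; [exact HK|].
  replace (kap * (INR n + 1) ^ m * (INR n + 1)) with (kap * (INR n + 1) * (INR n + 1) ^ m) by ring.
  apply Rmult_le_compat_r; lra. }
assert (kap * 1 <= kap * (INR n + 1) ^ m) by (apply Rmult_le_compat_l; lra).
fold u. lra.
Qed.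

(** If a whole window were small, the combination would be at most B * (t * rho) ^ n, which tends to
    0 and falls below kap. *)
Lemma large_coeff_in_window (rho t : R) (l : list C) (a : nat -> C) (kap : R) (N : nat) :
  0 < rho -> 0 < t -> t * rho < 1 -> 0 < kap ->
  (forall b, In b l -> Cmod b = rho) ->
  (forall n, (N <= n)%nat -> kap <= Cmod (mul_roots l a n) * rho ^ n) ->
  exists N', forall n, (N' <= n)%nat ->
    exists j, (n <= j <= n + length l)%nat /\ t ^ j < Cmod (a j).
Proof.
intros Hrho Ht Htr Hkap Hl HN.
(* The three factors come from the root factors, from t ^ (j - n) inside the window, and from rho ^
   (n + length l) in place of rho ^ n. *)
set (B := (1 + rho) ^ length l * (1 + t) ^ length l * rho ^ length l).
assert (HB : 0 < B) by (unfold B; repeat apply Rmult_lt_0_compat; apply pow_lt; lra).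
destruct (pow_lt_1_zero (t * rho) ltac:(rewrite Rabs_right; [lra|apply Rle_ge, Rmult_le_pos; lra])
  (kap / B) ltac:(apply Rdiv_lt_0_compat; lra)) as [N1 HN1].
exists (Nat.max N N1). intros n Hn. apply NNPP. intros Hno.
assert (Hsmall : forall j, (n <= j <= n + length l)%nat -> Cmod (a j) <= t ^ n * (1 + t) ^ length l).
{ intros j Hj. apply Rle_trans with (t ^ j).
  - apply Rnot_lt_le. intros Hlt. apply Hno. exists j. split; assumption.
  - replace j with (n + (j - n))%nat by lia. rewrite pow_add.
    apply Rmult_le_compat_l; [apply pow_le; lra|].
    apply Rle_trans with ((1 + t) ^ (j - n)); [apply pow_incr; lra|].
    apply Rle_pow; [lra|lia]. }
assert (H1 := Cmod_mul_roots_le rho l a _ n ltac:(lra) Hl Hsmall).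
assert (H2 := HN (n + length l)%nat ltac:(lia)).
specialize (HN1 n ltac:(lia)). rewrite Rabs_right in HN1
  by (apply Rle_ge, pow_le, Rmult_le_pos; lra).
apply Rmult_lt_compat_r with (r := B) in HN1; [|exact HB].
replace (kap / B * B) with kap in HN1 by (field; lra).
rewrite Rpow_mult_distr in HN1. rewrite pow_add in H2.
assert (Hp : 0 < rho ^ n * rho ^ length l) by (apply Rmult_lt_0_compat; apply pow_lt; lra).
apply Rmult_le_compat_r with (r := rho ^ n * rho ^ length l) in H1; [|lra].
unfold B in HN1. lra.
Qed.

(** At alpha the order is exact because c 0 <> 0. Elsewhere an upper bound suffices, and powers of z
    - w raise any smaller order bound to the maximal one. *)
Lemma max_order_pole (rho : R) (f : C -> C) (l : list C) : l <> nil ->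
  (forall w, In w l -> exists m c, local_series rho (fun z => ((z - w) ^ S m * f z)%C) w c /\ c 0%nat <> 0) ->
  exists alpha m c, In alpha l /\ local_series rho (fun z => ((z - alpha) ^ S m * f z)%C) alpha c /\
    c 0%nat <> 0 /\ forall w, In w l -> regular_at rho (fun z => ((z - w) ^ S m * f z)%C) w.
Proof.
assert (Hup : forall w m m' , (m <= m')%nat -> regular_at rho (fun z => ((z - w) ^ S m * f z)%C) w ->
  regular_at rho (fun z => ((z - w) ^ S m' * f z)%C) w).
{ intros w m m' Hm H.
  apply regular_at_ext with (fun z => ((z - w) ^ (m' - m) * ((z - w) ^ S m * f z))%C).
  - intros z _. rewrite Cmult_assoc, <- Cpow_add_r. do 2 f_equal. lia.
  - apply regular_at_mul_pow, H. }
induction l as [|x l IH]; [contradiction|]. intros _ H.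
destruct (H x (or_introl eq_refl)) as (m & c & Hc & Hc0).
destruct (classic (l = nil)) as [->|Hl].
- exists x, m, c. repeat split; [left; reflexivity|apply Hc|apply Hc|exact Hc0|].
  intros w [<-|[]]. exists c. exact Hc.
- destruct (IH Hl (fun w Hw => H w (or_intror Hw))) as (al & m' & c' & Hal & Hc' & Hc0' & Hr).
  destruct (le_lt_dec m m') as [Hm|Hm].
  + exists al, m', c'. split; [right; exact Hal|]. split; [exact Hc'|]. split; [exact Hc0'|].
    intros w [<-|Hw]; [|apply Hr, Hw]. apply (Hup x m m' Hm). exists c. exact Hc.
  + exists x, m, c. split; [left; reflexivity|]. split; [exact Hc|]. split; [exact Hc0|].
    intros w [<-|Hw]; [exists c; exact Hc|]. apply (Hup w m' m ltac:(lia)), Hr, Hw.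
Qed.

(** * Poles on the circle *)

Lemma psum_of_cpseries (c : nat -> C) (w z v : C) : is_cpseries c (z - w)%C v -> psum c w z v.
Proof. apply is_cpseriesE. Qed.

Lemma psum_center (c : nat -> C) (w v : C) : psum c w w v -> v = c 0%nat.
Proof.
intros H. apply (csum_unique _ _ _ H).
replace (c 0%nat) with (c 0%nat * (w - w) ^ 0)%C by (simpl; ring).
apply (csum_single (fun n => (c n * (w - w) ^ n)%C)).
intros [|n] Hn; [lia|]. rewrite Cpow_S. ring.
Qed.

Lemma analytic_at_geometric (f : C -> C) (z0 : C) : analytic_at f z0 ->
  exists c K q r, 0 < q /\ 0 < r /\ (forall n, Cmod (c n) <= K * q ^ n) /\
    forall z, Cmod (z - z0)%C < r -> psum c z0 z (f z).
Proof.
intros (c & r & Hr & H).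
assert (H' : forall z, Cmod (z - z0)%C < r -> psum c z0 z (f z)) by (intros; apply psum_of_cpseries, H; assumption).
destruct (psum_coeff_bounded c z0 (f (z0 + (r / 2)%R)%C) (r / 2) ltac:(lra)) as (K & _ & HK).
{ apply H'. replace (z0 + (r / 2)%R - z0)%C with (RtoC (r / 2)) by ring.
  rewrite Cmod_R, Rabs_right; lra. }
assert (Hi : 0 < / (r / 2)) by (apply Rinv_0_lt_compat; lra).
exists c, K, (/ (r / 2)), r. repeat split; auto.
intros n. specialize (HK n). rewrite pow_inv.
apply Rmult_le_reg_r with ((r / 2) ^ n); [apply pow_lt; lra|].
rewrite Rmult_assoc, Rinv_l by (apply pow_nonzero; lra). lra.
Qed.

Lemma analytic_at_locally_bounded (f : C -> C) (z0 : C) : analytic_at f z0 ->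
  exists B d, 0 < d /\ forall z, Cmod (z - z0)%C < d -> Cmod (f z) <= B.
Proof.
intros H. destruct (analytic_at_geometric f z0 H) as (c & K & q & r & Hq & Hr & Hc & Hs).
exists (2 * K * INR (fact 0) * (2 * q) ^ 0), (Rmin r (/ (4 * q))).
assert (H4 : 0 < / (4 * q)) by (apply Rinv_0_lt_compat; lra).
split; [apply Rmin_pos; lra|]. intros z Hz.
assert (Hm1 := Rmin_l r (/ (4 * q))). assert (Hm2 := Rmin_r r (/ (4 * q))).
apply (psum_dseqn_bound c K q z0 z (f z) 0 Hq Hc); [|apply Hs; lra].
apply Rmult_le_reg_l with (/ (4 * q)); [exact H4|]. rewrite <- Rmult_assoc, Rinv_l; lra.
Qed.

Lemma analytic_at_lipschitz (f : C -> C) (z0 : C) : analytic_at f z0 ->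
  exists L d, 0 < L /\ 0 < d /\ forall h, Cmod h < d -> Cmod (f (z0 + h) - f z0)%C <= L * Cmod h.
Proof.
intros H. destruct (analytic_at_geometric f z0 H) as (c & K & q & r & Hq & Hr & Hc & Hs).
assert (Hac := absconv_of_geometric c K q Hq Hc).
assert (H0 : Cmod (z0 - z0)%C < / q).
{ replace (z0 - z0)%C with (RtoC 0) by ring. rewrite Cmod_0. apply Rinv_0_lt_compat, Hq. }
destruct (psum_ex (dseq c) (/ q) z0 z0 (absconv_dseq _ _ Hac) H0) as [l Hl].
destruct (psum_deriv c f (/ q) r z0 z0 l Hac H0 Hr Hs Hl 1 Rlt_0_1) as (d & Hd & Hdl).
exists (1 + Cmod l), d. split; [generalize (Cmod_ge_0 l); lra|]. split; [exact Hd|].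
intros h Hh. specialize (Hdl h Hh).
replace (f (z0 + h) - f z0)%C with ((f (z0 + h) - f z0 - l * h) + l * h)%C by ring.
eapply Rle_trans; [apply Cmod_triangle|]. rewrite Cmod_mult. lra.
Qed.

(** At distance x from z0 the numerator still exceeds half of Cmod (g z0) while the denominator is
    at most x. *)
Lemma pole_at_unbounded (f : C -> C) (z0 : C) (B d : R) : pole_at f z0 -> 0 < d ->
  exists y, Cmod (y - z0)%C < d /\ B < Cmod (f y).
Proof.
intros (m & g & r & Hm & Hg & Hg0 & Hr & Hf) Hd.
destruct (analytic_at_lipschitz g z0 Hg) as (L & d' & HL & Hd' & Hlip).
assert (G := proj1 (Cmod_gt_0 _) Hg0). set (G0 := Cmod (g z0)) in *.
assert (HB : 0 <= Rabs B) by apply Rabs_pos.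
(* In turn: the required nearness, the range of the quotient formula, the range of the Lipschitz
   bound, x ^ m <= x, numerator above G0 / 2, and G0 / 2 above (Rabs B + 1) * x. *)
set (x := Rmin (Rmin (Rmin d r) (Rmin d' 1)) (Rmin (G0 / (2 * L)) (G0 / (2 * (Rabs B + 1)))) / 2).
assert (P1 : 0 < G0 / (2 * L)) by (apply Rdiv_lt_0_compat; lra).
assert (P2 : 0 < G0 / (2 * (Rabs B + 1))) by (apply Rdiv_lt_0_compat; lra).
assert (Hx : 0 < x) by (unfold x; apply Rdiv_lt_0_compat; [repeat apply Rmin_pos; lra|lra]).
assert (M1 := Rmin_l (Rmin (Rmin d r) (Rmin d' 1)) (Rmin (G0 / (2 * L)) (G0 / (2 * (Rabs B + 1))))).
assert (M2 := Rmin_r (Rmin (Rmin d r) (Rmin d' 1)) (Rmin (G0 / (2 * L)) (G0 / (2 * (Rabs B + 1))))).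
assert (M3 := Rmin_l (Rmin d r) (Rmin d' 1)). assert (M4 := Rmin_r (Rmin d r) (Rmin d' 1)).
assert (M5 := Rmin_l d r). assert (M6 := Rmin_r d r).
assert (M7 := Rmin_l d' 1). assert (M8 := Rmin_r d' 1).
assert (M9 := Rmin_l (G0 / (2 * L)) (G0 / (2 * (Rabs B + 1)))).
assert (M10 := Rmin_r (G0 / (2 * L)) (G0 / (2 * (Rabs B + 1)))).
assert (Hxs : x < d /\ x < r /\ x < d' /\ x < 1 /\ x < G0 / (2 * L) /\ x < G0 / (2 * (Rabs B + 1)))
  by (unfold x in *; lra).
destruct Hxs as (X1 & X2 & X3 & X4 & X5 & X6).
clear M1 M2 M3 M4 M5 M6 M7 M8 M9 M10. clearbody x.
assert (Hxm : Cmod x = x) by (rewrite Cmod_R; apply Rabs_right; lra).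
exists (z0 + x)%C.
assert (E : (z0 + x - z0)%C = x) by ring.
assert (Exm : Cmod (z0 + x - z0)%C = x) by (rewrite E; exact Hxm).
split; [lra|]. rewrite Hf by lra. rewrite E.
assert (Hxn : RtoC x <> 0) by (intros E'; apply RtoC_inj in E'; lra).
rewrite Cmod_div by (apply Cpow_nz; exact Hxn). rewrite Cmod_pow, Hxm.
specialize (Hlip x ltac:(lra)). rewrite Hxm in Hlip.
assert (HLx : L * x < G0 / 2).
{ apply Rmult_lt_compat_l with (r := L) in X5; [|exact HL].
  replace (L * (G0 / (2 * L))) with (G0 / 2) in X5 by (field; lra). exact X5. }
assert (Hg2 : G0 / 2 < Cmod (g (z0 + x)%C)).
{ assert (T := Cmod_triangle (g (z0 + x)%C) (- (g (z0 + x) - g z0))%C). rewrite Cmod_opp in T.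
  replace (g (z0 + x) + - (g (z0 + x) - g z0))%C with (g z0) in T by ring. fold G0 in T. lra. }
assert (Hpm : x ^ m <= x).
{ destruct m as [|m]; [lia|]. simpl. rewrite <- (Rmult_1_r x) at 3.
  apply Rmult_le_compat_l; [lra|]. rewrite <- (pow1 m). apply pow_incr. lra. }
assert (Hpp : 0 < x ^ m) by (apply pow_lt; lra).
apply Rmult_lt_reg_r with (x ^ m); [exact Hpp|].
unfold Rdiv. rewrite Rmult_assoc, Rinv_l by lra. rewrite Rmult_1_r.
apply Rle_lt_trans with ((Rabs B + 1) * x).
- assert (HBa := RRle_abs B). apply Rle_trans with ((Rabs B + 1) * x ^ m).
  + apply Rmult_le_compat_r; lra.
  + apply Rmult_le_compat_l; lra.
- apply Rmult_lt_compat_l with (r := Rabs B + 1) in X6; [|lra].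
  replace ((Rabs B + 1) * (G0 / (2 * (Rabs B + 1)))) with (G0 / 2) in X6 by (field; lra). lra.
Qed.

(** In either case f is bounded near each point z <> t close to t, whereas it is unbounded near a
    pole. *)
Lemma poles_isolated (f : C -> C) (t : C) : analytic_at f t \/ pole_at f t ->
  exists d, 0 < d /\ forall z, 0 < Cmod (z - t)%C < d -> ~ pole_at f z.
Proof.
intros [H|(m & g & r & Hm & Hg & Hg0 & Hr & Hf)].
- destruct (analytic_at_locally_bounded f t H) as (B & d & Hd & HB).
  exists d. split; [exact Hd|]. intros z Hz Hp.
  destruct (pole_at_unbounded f z B (d - Cmod (z - t)%C) Hp ltac:(lra)) as (y & Hy & Hyb).
  assert (Cmod (y - t)%C < d).
  { replace (y - t)%C with ((y - z) + (z - t))%C by ring.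
    eapply Rle_lt_trans; [apply Cmod_triangle|]. lra. }
  specialize (HB y ltac:(assumption)). lra.
- destruct (analytic_at_locally_bounded g t Hg) as (B & d & Hd & HB).
  exists (Rmin r d). split; [apply Rmin_pos; assumption|]. intros z Hz Hp.
  assert (M1 := Rmin_l r d). assert (M2 := Rmin_r r d).
  set (x := Cmod (z - t)%C) in *.
  (* Points y within x / 2 of z satisfy Cmod (y - t) > x / 2, so B / (x / 2) ^ m bounds f there. *)
  destruct (pole_at_unbounded f z (B / (x / 2) ^ m) (Rmin (x / 2) (Rmin r d - x)) Hp
    ltac:(apply Rmin_pos; lra)) as (y & Hy & Hyb).
  assert (M3 := Rmin_l (x / 2) (Rmin r d - x)). assert (M4 := Rmin_r (x / 2) (Rmin r d - x)).
  assert (Hy1 : Cmod (y - t)%C < Rmin r d).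
  { replace (y - t)%C with ((y - z) + (z - t))%C by ring.
    eapply Rle_lt_trans; [apply Cmod_triangle|]. fold x. lra. }
  assert (Hy2 : x / 2 < Cmod (y - t)%C).
  { assert (T := Cmod_triangle (- (y - z))%C (y - t)%C). rewrite Cmod_opp in T.
    replace (- (y - z) + (y - t))%C with (z - t)%C in T by ring. fold x in T. lra. }
  assert (Hyt : (y - t)%C <> 0) by (apply Cmod_gt_0; lra).
  rewrite Hf in Hyb by lra.
  rewrite Cmod_div in Hyb by (apply Cpow_nz, Hyt). rewrite Cmod_pow in Hyb.
  specialize (HB y ltac:(lra)).
  apply (Rlt_not_le _ _ Hyb). unfold Rdiv at 1. unfold Rdiv at 1.
  apply Rmult_le_compat; [apply Cmod_ge_0| |exact HB|].
  + apply Rlt_le, Rinv_0_lt_compat, pow_lt. lra.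
  + apply Rinv_le_contravar; [apply pow_lt; lra|]. apply pow_incr. lra.
Qed.

Lemma nodup_sublist_exists {T : Type} (P : T -> Prop) (l : list T) :
  exists l', NoDup l' /\ forall x, In x l' <-> In x l /\ P x.
Proof.
induction l as [|y l (l' & Hnd & H)].
- exists nil. split; [constructor|]. simpl. tauto.
- destruct (classic (P y /\ ~ In y l')) as [[Hy Hn]|Hy].
  + exists (y :: l'). split; [constructor; assumption|].
    intros x. simpl. rewrite H. split; [|tauto]. intros [<-|Hx]; tauto.
  + exists l'. split; [exact Hnd|]. intros x. simpl. rewrite H. split; [tauto|].
    intros [[<-|Hx] Px]; [|tauto]. apply H. apply NNPP. tauto.
Qed.

(** Cover the disk by balls that contain no pole on the circle except possibly their centre; every
    such pole is then one of the finitely many centres. *)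
Lemma circle_poles_finite (f : C -> C) (rho : R) :
  (forall z, Cmod z = rho -> analytic_at f z \/ pole_at f z) ->
  exists l, NoDup l /\ forall z, In z l <-> Cmod z = rho /\ pole_at f z.
Proof.
intros H.
destruct (functional_choice (fun w d => 0 < d /\
   forall z, Cmod z = rho -> 0 < Cmod (z - w)%C < d -> ~ pole_at f z)) as [delta Hdelta].
{ intros w. destruct (Req_dec (Cmod w) rho) as [E|E].
  - destruct (poles_isolated f w (H w E)) as (d & Hd & Hdz). exists d. split; [exact Hd|]. auto.
  - exists (Rabs (Cmod w - rho)). split; [apply Rabs_pos_lt; lra|].
    intros z Hz [_ Hzw] _. apply (Rlt_not_le _ _ Hzw). apply Rabs_le.
    assert (T1 := Cmod_triangle (z - w)%C w). replace (z - w + w)%C with z in T1 by ring.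
    assert (T2 := Cmod_triangle (- (z - w))%C z). rewrite Cmod_opp in T2.
    replace (- (z - w) + z)%C with w in T2 by ring. lra. }
destruct (finite_subcover rho delta (fun w => proj1 (Hdelta w))) as [l Hl].
destruct (nodup_sublist_exists (fun z => Cmod z = rho /\ pole_at f z) l) as (l' & Hnd & Hl').
exists l'. split; [exact Hnd|]. intros z. rewrite Hl'. split; [tauto|]. intros [Hz Hp].
split; [|split; assumption].
destruct (Hl z ltac:(lra)) as (t & Ht & Hzt).
destruct (classic (z = t)) as [->|Hne]; [exact Ht|].
exfalso. apply (proj2 (Hdelta t) z Hz); [|exact Hp]. split; [|exact Hzt].
apply Cmod_gt_0. intros E. apply Hne. replace z with (z - t + t)%C by ring. rewrite E. ring.
Qed.

Lemma analytic_at_regular (f : C -> C) (rho : R) (w : C) : analytic_at f w -> regular_at rho f w.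
Proof.
intros H. destruct (analytic_at_geometric f w H) as (c & K & q & r & Hq & Hr & Hc & Hs).
exists c. split; [exists K, q; auto|]. exists r. split; [exact Hr|]. intros z _. apply Hs.
Qed.

(** The numerator g of the pole gives the expansion. With radius Cmod w every tested z differs from
    w, so the quotient formula applies. *)
Lemma pole_at_local_series (f : C -> C) (w : C) : pole_at f w ->
  exists m c, local_series (Cmod w) (fun z => ((z - w) ^ S m * f z)%C) w c /\ c 0%nat <> 0.
Proof.
intros (m & g & r & Hm & Hg & Hg0 & Hr & Hf).
destruct (analytic_at_geometric g w Hg) as (c & K & q & r' & Hq & Hr' & Hc & Hs).
exists (pred m), c. replace (S (pred m)) with m by lia. split.
- split; [exists K, q; auto|]. exists (Rmin r r'). split; [apply Rmin_pos; assumption|].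
  intros z Hz Hzw. assert (M1 := Rmin_l r r'). assert (M2 := Rmin_r r r').
  assert (Hnz : (z - w)%C <> 0).
  { intros E. apply (neq_of_Cmod_lt z w (Cmod w) Hz (Rle_refl _)).
    replace z with (z - w + w)%C by ring. rewrite E. ring. }
  rewrite Hf by (split; [apply Cmod_gt_0, Hnz|lra]).
  replace ((z - w) ^ m * (g z / (z - w) ^ m))%C with (g z) by (field; apply Cpow_nz, Hnz).
  apply Hs. lra.
- intros E. apply Hg0. rewrite <- E. apply (psum_center c w). apply Hs.
  replace (w - w)%C with (RtoC 0) by ring. rewrite Cmod_0. exact Hr'.
Qed.

(** * Counting large coefficients and the limsup *)

Lemma large_count_le (a : nat -> C) (t : R) (n k : nat) :
  (large_count a t n <= large_count a t (n + k))%nat.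
Proof. unfold large_count. rewrite seq_app, filter_app, length_app. lia. Qed.

Lemma large_count_window (a : nat -> C) (t : R) (n p j : nat) :
  (n <= j < n + p)%nat -> t ^ j < Cmod (a j) ->
  (S (large_count a t n) <= large_count a t (n + p))%nat.
Proof.
intros Hj Ht. unfold large_count. rewrite seq_app, filter_app, length_app. simpl (0 + n)%nat.
set (P := fun j => if Rlt_dec (t ^ j) (Cmod (a j)) then true else false).
assert (Hin : In j (filter P (seq n p))).
{ apply filter_In. split; [apply in_seq; lia|]. unfold P. destruct (Rlt_dec _ _); tauto. }
destruct (filter P (seq n p)); [destruct Hin|simpl; lia].
Qed.

(** From N on, each block of p indices adds at least one large coefficient; N + p absorbs the
    initial segment and the incomplete last block. *)
Lemma large_count_linear (a : nat -> C) (t : R) (N p : nat) :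
  (forall n, (N <= n)%nat -> exists j, (n <= j < n + p)%nat /\ t ^ j < Cmod (a j)) ->
  forall n, (n <= N + p + p * large_count a t n)%nat.
Proof.
intros H.
assert (Hp : (0 < p)%nat) by (destruct (H N (le_n _)) as (j & Hj & _); lia).
assert (Hk : forall k, (k <= large_count a t (N + k * p))%nat).
{ induction k as [|k IH]; [lia|].
  destruct (H (N + k * p)%nat ltac:(lia)) as (j & Hj & Hlt).
  assert (Hw := large_count_window a t (N + k * p) p j Hj Hlt).
  replace (N + S k * p)%nat with (N + k * p + p)%nat by lia. lia. }
intros n. destruct (le_lt_dec n N) as [Hn|Hn]; [lia|].
assert (Hdiv := Nat.div_mod (n - N) p ltac:(lia)).
assert (Hmod := Nat.mod_upper_bound (n - N) p ltac:(lia)).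
set (k := ((n - N) / p)%nat) in *.
assert (H1 := Hk k). assert (H2 := large_count_le a t (N + k * p) (n - (N + k * p))).
replace (N + k * p + (n - (N + k * p)))%nat with n in H2 by nia. nia.
Qed.

(** For each e > 0 the ratio is eventually at most p + e: otherwise n > (p + e) * v n, and n <= A +
    p * v n gives e * n <= (p + e) * A, which fails for large n. *)
Lemma limsup_ratio_le (v : nat -> nat) (A p : nat) : (forall n, (n <= A + p * v n)%nat) ->
  Rbar_le (LimSup_seq (fun n => INR n / INR (v n))) (Finite (INR p)).
Proof.
intros H.
assert (He : forall e, 0 < e -> Rbar_le (LimSup_seq (fun n => INR n / INR (v n))) (Finite (INR p + e))).
{ intros e He. rewrite <- (LimSup_seq_const (INR p + e)). apply LimSup_le.
  destruct (INR_unbounded ((INR p + e) * INR A / e)) as [N HN].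
  assert (Hp := pos_INR p). assert (HA := pos_INR A).
  exists N. intros n Hn. apply le_INR in Hn.
  assert (Hn1 : (INR p + e) * INR A < e * INR n).
  { apply Rmult_lt_reg_r with (/ e); [apply Rinv_0_lt_compat, He|].
    replace (e * INR n * / e) with (INR n) by (field; lra). unfold Rdiv in HN. lra. }
  specialize (H n). apply le_INR in H. rewrite plus_INR, mult_INR in H.
  destruct (Nat.eq_dec (v n) 0) as [E|E].
  - rewrite E. simpl. unfold Rdiv. rewrite Rinv_0. lra.
  - assert (Hv : 0 < INR (v n)) by (apply lt_0_INR; lia).
    apply Rmult_le_reg_r with (INR (v n)); [exact Hv|].
    unfold Rdiv. rewrite Rmult_assoc, Rinv_l, Rmult_1_r by lra.
    destruct (Rle_lt_dec (INR n) ((INR p + e) * INR (v n))) as [|Hlt]; [assumption|exfalso].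
    assert (H3 : (INR p + e) * INR n <= (INR p + e) * INR A + INR p * ((INR p + e) * INR (v n))).
    { replace ((INR p + e) * INR A + INR p * ((INR p + e) * INR (v n)))
        with ((INR p + e) * (INR A + INR p * INR (v n))) by ring.
      apply Rmult_le_compat_l; lra. }
    assert (H4 : INR p * ((INR p + e) * INR (v n)) <= INR p * INR n) by (apply Rmult_le_compat_l; lra).
    lra. }
destruct (LimSup_seq _) as [x| |]; simpl in *.
- apply le_epsilon. exact He.
- exact (He 1 Rlt_0_1).
- exact I.
Qed.

(* [n / v_n] is 0 when [v_n = 0]; under the hypotheses this happens for at most
   finitely many [n], so it does not affect the limsup. *)
Theorem theorem2p2 (a : nat -> C) (rho rho1 eps : R) (f : C -> C)
  (rho_gt0 : 0 < rho)
  (radius_a : cradius a = Finite rho)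
  (rho_lt_rho1 : rho < rho1)
  (f_cont : continues_with_poles_on_circle a rho rho1 f)
  (eps_gt0 : 0 < eps)
  (eps_small : 1 / rho1 < 1 / rho - 2 * eps) :
  exists p : nat,
    has_card (fun z : C => Cmod z = rho /\ pole_at f z) p /\
    Rbar_le (LimSup_seq (fun n => INR n / INR (large_count a (1 / rho - eps) n)))
            (Finite (INR p)).
Proof.
destruct f_cont as [Hser Hcont].
assert (Ha : forall z, Cmod z < rho -> psum a 0 z (f z)).
{ intros z Hz. apply psum_of_cpseries. replace (z - 0)%C with z by ring. apply Hser, Hz. }
assert (Hcirc : forall z, Cmod z = rho -> analytic_at f z \/ pole_at f z).
{ intros z Hz. destruct (Hcont z ltac:(lra)) as [H|[_ H]]; [left|right]; exact H. }
destruct (circle_poles_finite f rho Hcirc) as (l & Hnd & Hl).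
assert (Hreg : forall w, Cmod w = rho -> ~ In w l -> regular_at rho f w).
{ intros w Hw Hwl. apply analytic_at_regular.
  destruct (Hcirc w Hw) as [H|H]; [exact H|]. exfalso. apply Hwl, Hl. split; assumption. }
exists (length l). split; [exists l; split; [exact Hnd|split; [exact Hl|reflexivity]]|].
(* Without poles the coefficients would be bounded at some radius r > rho, against [radius_a]. *)
assert (Hne : l <> nil).
{ intros ->. destruct (coeff_decay_of_regular a rho f rho_gt0 Ha) as (r & K & Hr & HK).
  - intros w Hw. apply Hreg; [exact Hw|intros []].
  - assert (H := proj1 (CV_radius_bounded (fun n => Cmod (a n)))).
    unfold cradius in radius_a. rewrite radius_a in H.
    specialize (H r). simpl in H.
    assert (r <= rho); [|lra]. apply H. exists K. intros n.
    rewrite Rabs_right; [apply HK|].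
    apply Rle_ge, Rmult_le_pos; [apply Cmod_ge_0|apply pow_le; lra]. }
destruct (max_order_pole rho f l Hne) as (alpha & m & c & Hal & Hc & Hc0 & Hmax).
{ intros w Hw. apply Hl in Hw. destruct Hw as [<- Hp]. apply pole_at_local_series, Hp. }
destruct (in_split alpha l Hal) as (l1 & l2 & El).
assert (Hin : forall w, In w (alpha :: l1 ++ l2) <-> In w l).
{ intros w. rewrite El. simpl. rewrite !in_app_iff. simpl. tauto. }
assert (Hlen : length l = S (length (l1 ++ l2))).
{ rewrite El, !length_app. simpl. lia. }
assert (Hrho : forall w, In w l -> Cmod w = rho) by (intros w Hw; apply Hl, Hw).
destruct (dominant_pole_lower_bound rho (l1 ++ l2) a f alpha m c rho_gt0 Ha (Hrho _ Hal))
  as (kap & N & Hkap & HN).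
{ rewrite El in Hnd. apply NoDup_remove_2 in Hnd. exact Hnd. }
{ split.
  - intros w Hw Hwl. apply Hreg; [exact Hw|]. rewrite <- Hin. exact Hwl.
  - intros w Hw. apply Hin in Hw. split; [apply Hrho, Hw|apply Hmax, Hw]. }
{ exact Hc. }
{ exact Hc0. }
(* Through [eps_small] this makes the base 1 / rho - eps of the threshold positive. *)
assert (Hr1 : 0 < 1 / rho1) by (apply Rdiv_lt_0_compat; lra).
destruct (large_coeff_in_window rho (1 / rho - eps) (l1 ++ l2) a kap N rho_gt0) as [N' HN']; auto.
{ lra. }
{ replace ((1 / rho - eps) * rho) with (1 - eps * rho) by (field; lra).
  assert (0 < eps * rho) by (apply Rmult_lt_0_compat; lra). lra. }
{ intros b Hb. apply Hrho, Hin. right. exact Hb. }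
apply limsup_ratio_le with (A := (N' + length l)%nat).
apply large_count_linear.
(* l1 ++ l2 omits alpha, so j <= n + length (l1 ++ l2) is the same as j < n + length l: windows of
   exactly p indices. *)
intros n Hn. destruct (HN' n Hn) as (j & Hj & Hlt). exists j. split; [lia|exact Hlt].
Qed.
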